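(* Let $(\Gamma,\Gamma_0)$ be a Hecke pair, let $\Sigma:=\{\sigma\in\Gamma : L(\sigma)=1\}$, and suppose that $\Sigma^{-1}\Sigma=\Gamma$ (i.e. every element of $\Gamma$ has the form $\tau^{-1}\sigma$ with $\tau,\sigma\in\Sigma$). For $\sigma\in\Sigma$ put $W_\sigma:=R(\sigma)^{-1/2}[\sigma]\in\mathcal H(\Gamma,\Gamma_0)$. Then the set $\{W_\tau^*W_\sigma : \tau,\sigma\in\Sigma\}$ is a linear basis of $\mathcal H(\Gamma,\Gamma_0)$, and the universal $C^*$-enveloping algebra $C^*_u(\Gamma,\Gamma_0)$ of $\mathcal H(\Gamma,\Gamma_0)$ (exists and) is a quotient of the universal $C^*$-algebra of isometric representations of $\Sigma$.
   Context: A group--subgroup pair $(\Gamma,\Gamma_0)$ is a Hecke pair if every double coset $\Gamma_0\gamma\Gamma_0$ ($\gamma\in\Gamma$) is a finite union of left cosets $\gamma_i\Gamma_0$ (equivalently, every double coset is a finite union of right cosets $\Gamma_0\gamma_i$). The Hecke $*$-algebra $\mathcal H(\Gamma,\Gamma_0)$ is the vector space of $\Gamma_0$-biinvariant functions $\Gamma\to\mathbb C$ supported on finitely many double cosets, with product $(f*g)(\gamma)=\sum_{\gamma_1\in\Gamma_0\backslash\Gamma}f(\gamma\gamma_1^{-1})g(\gamma_1)$ and involution $f^*(\gamma)=\overline{f(\gamma^{-1})}$; its unit is the characteristic function of $\Gamma_0$. $[\gamma]$ denotes the characteristic function of $\Gamma_0\gamma\Gamma_0$. $R(\gamma)$ is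 the number of right cosets $\Gamma_0\delta$ contained in $\Gamma_0\gamma\Gamma_0$, and $L(\gamma)=R(\gamma^{-1})$ is the number of left cosets $\delta\Gamma_0$ contained in $\Gamma_0\gamma\Gamma_0$. The set $\Sigma$ is a subsemigroup of $\Gamma$ on which $R$ is multiplicative, and $\sigma\mapsto W_\sigma$ is a representation of $\Sigma$ by isometries in $\mathcal H(\Gamma,\Gamma_0)$, i.e. $W_\sigma^*W_\sigma=1$ and $W_\sigma W_\tau=W_{\sigma\tau}$. $\{W_\tau^*W_\sigma\}$ is understood as a set of elements (possible repetitions are ignored). The universal $C^*$-enveloping algebra of a unital $*$-algebra $\mathcal A$ exists if for each $a\in\mathcal A$ the supremum of $\|\pi(a)\|$ over all $*$-representations $\pi$ of $\mathcal A$ by bounded operators on Hilbert spaces is finite; it is then the $C^*$-algebra obtained by (Hausdorff) completion of $\mathcal A$ in this seminorm, and all $*$-representations of $\mathcal A$ on Hilbert space factor through it. The universal $C^*$-algebra of isometric representations of $\Sigma$ is the universal unital $C^*$-algebra generated by isometries $v_\sigma$ ($\sigma\in\Sigma$) with $v_\sigma v_\tau=v_{\sigma\tau}$. *)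

(* Defs.v *)
From HB Require Import structures.
From mathcomp Require Import all_boot all_order all_algebra.
From mathcomp Require Import finmap.
From mathcomp Require Import boolp classical_sets functions cardinality fsbigop.
From mathcomp Require Import reals ereal topology normedtype.
From mathcomp Require Import complex sesquilinear.

Set Implicit Arguments.
Unset Strict Implicit.
Unset Printing Implicit Defensive.

Import Order.TTheory GRing.Theory Num.Theory.
Import numFieldNormedType.Exports.

Local Open Scope classical_set_scope.
Local Open Scope ring_scope.

(* As for every algType, the zero algebra is excluded. *)
HB.mixin Record isStarAlgebra (R : realType) A of GRing.Algebra R[i] A := {
  star : A -> A;
  starD : {morph star : a b / a + b};
  starZ : forall (k : R[i]) (a : A), star (k *: a) = k^* *: star a;
  starM : forall a b : A, star (a * b) = star b * star a;
  starK : involutive star }.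

#[short(type="starAlgType")]
HB.structure Definition StarAlgebra (R : realType) :=
  {A of isStarAlgebra R A & GRing.Algebra R[i] A}.

(* The norm is a field of its own, as MathComp's hierarchy has no structure below
   numDomainType that joins a ring and a normed module. *)
HB.mixin Record isCStarAlgebra (R : realType) A of StarAlgebra R A := {
  cnorm : A -> R;
  cnormD : forall a b : A, cnorm (a + b) <= cnorm a + cnorm b;
  cnormZ : forall (k : R[i]) (a : A), cnorm (k *: a) = complex.Re `|k| * cnorm a;
  cnorm_eq0 : forall a : A, cnorm a = 0 -> a = 0;
  cnormM : forall a b : A, cnorm (a * b) <= cnorm a * cnorm b;
  cnorm_star : forall a : A, cnorm (star a * a) = cnorm a ^+ 2;
  cnorm_complete : forall u : nat -> A,
    (forall e : R, 0 < e -> exists N : nat, forall m n : nat,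
      (N <= m)%N -> (N <= n)%N -> cnorm (u m - u n) < e) ->
    exists l : A, forall e : R, 0 < e -> exists N : nat, forall n : nat,
      (N <= n)%N -> cnorm (u n - l) < e }.

#[short(type="cstarAlgType")]
HB.structure Definition CStarAlgebra (R : realType) :=
  {A of isCStarAlgebra R A & StarAlgebra R A}.

(* {dot H for conj} is linear in the first argument, conjugate-linear in the second. *)
HB.mixin Record isHilbert (R : realType) H
    of CompleteNormedModule R[i] H := {
  inner : {dot H for Num.conj};
  inner_norm : forall x : H, inner x x = `|x| ^+ 2 }.

#[short(type="hilbertType")]
HB.structure Definition Hilbert (R : realType) :=
  {H of isHilbert R H & CompleteNormedModule R[i] H}.

Section StarAlgebraTheory.
Variable R : realType.

Definition star_preserving (A B : starAlgType R) (f : A -> B) : Prop :=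
  forall a, f (star a) = star (f a).

Definition cclosure (A : cstarAlgType R) (D : set A) : set A :=
  [set b | forall e : R, 0 < e -> exists2 a, D a & cnorm (b - a) < e].

(* A surjective *-homomorphism U -> B, i.e. B is U modulo a closed *-ideal. *)
Definition is_quotient (U B : cstarAlgType R) : Prop :=
  exists phi : {lrmorphism U -> B},
    star_preserving phi /\ forall b, exists a, phi a = b.

(* The basis is a set, so that repetitions play no role. *)
Definition linear_basis (V : lmodType R[i]) (E : set V) : Prop :=
  (forall (s : seq V) (c : V -> R[i]), uniq s -> [set` s] `<=` E ->
     \sum_(e <- s) c e *: e = 0 -> forall e, e \in s -> c e = 0) /\
  (forall x : V, exists (s : seq V) (c : V -> R[i]),
     [set` s] `<=` E /\ x = \sum_(e <- s) c e *: e).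

(* +oo when T is unbounded. *)
Definition opnorm (H : hilbertType R) (T : H -> H) : \bar R :=
  ereal_sup [set (complex.Re `|T x|)%:E | x in [set x : H | `|x| <= 1]].

(* pi 1 need not be the identity: degenerate representations are allowed. *)
Record star_rep (A : starAlgType R) (H : hilbertType R) (pi : A -> H -> H) :
    Prop := StarRep {
  rep_op_linear : forall a, linear (pi a);
  rep_op_bounded : forall a, (opnorm (pi a) < +oo)%E;
  rep_linear : forall (k : R[i]) a b x, pi (k *: a + b) x = k *: pi a x + pi b x;
  rep_mul : forall a b x, pi (a * b) x = pi a (pi b x);
  rep_star : forall a x y, inner (pi (star a) x) y = inner x (pi a y) }.

Definition univ_norm (A : starAlgType R) (a : A) : \bar R :=
  ereal_sup [set r | exists (H : hilbertType R) (pi : A -> H -> H),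
                       star_rep pi /\ r = opnorm (pi a)].

Definition has_enveloping (A : starAlgType R) : Prop :=
  forall a : A, (univ_norm a < +oo)%E.

(* (B, iota) is the Hausdorff completion of A for univ_norm; it is determined up
   to isometric *-isomorphism under A. *)
Definition is_enveloping (A : starAlgType R) (B : cstarAlgType R)
    (iota : {lrmorphism A -> B}) : Prop :=
  [/\ star_preserving iota,
      forall a, (cnorm (iota a))%:E = univ_norm a
    & cclosure (range iota) = setT].

(* Only the values of v on the subsemigroup S of G matter. *)
Definition isometric_rep (G : semigroupType) (S : set G) (A : starAlgType R)
    (v : G -> A) : Prop :=
  (forall s, S s -> star (v s) * v s = 1) /\
  (forall s t, S s -> S t -> v s * v t = v (s * t)%g).

Definition closed_star_subalg (A : cstarAlgType R) (D : set A) : Prop :=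
  [/\ D 1, forall (k : R[i]) a b, D a -> D b -> D (k *: a + b),
      forall a b, D a -> D b -> D (a * b),
      forall a, D a -> D (star a) & cclosure D `<=` D].

(* phi is unique, since *-homomorphisms between C*-algebras are continuous and
   v @` S generates U. *)
Definition is_universal_isometric (G : semigroupType) (S : set G)
    (U : cstarAlgType R) (v : G -> U) : Prop :=
  [/\ isometric_rep S v,
      forall D : set U, closed_star_subalg D -> v @` S `<=` D -> D = setT
    & forall (B : cstarAlgType R) (w : G -> B), isometric_rep S w ->
        exists phi : {lrmorphism U -> B},
          star_preserving phi /\ forall s, S s -> phi (v s) = w s].

End StarAlgebraTheory.

Section Cosets.
Variables (G : groupType) (G0 : groupClosed G).
Local Open Scope group_scope.
Implicit Types x y z : G.

Local Notation ginv := (fun x : G => x^-1%g).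
Definition left_coset x : set G := [set y | exists2 h, h \in G0 & y = x * h].
Definition right_coset x : set G := [set y | exists2 h, h \in G0 & y = h * x].
Definition double_coset x : set G :=
  [set y | exists h k, [/\ h \in G0, k \in G0 & y = h * x * k]].

Definition hecke_pair : Prop := forall x, exists s : seq G,
  double_coset x = \bigcup_(y in [set` s]) left_coset y.

Definition right_cosets : set (set G) := range right_coset.
Definition left_cosets : set (set G) := range left_coset.

(* For a Hecke pair these sets of cosets are finite, so that fset_set is faithful. *)
Definition Rnum x : nat :=
  #|` fset_set [set X | right_cosets X /\ X `<=` double_coset x] |.
Definition Lnum x : nat :=
  #|` fset_set [set X | left_cosets X /\ X `<=` double_coset x] |.

(* Some element of X, for nonempty X. *)
Definition coset_repr (X : set G) : G := xget 1 X.

Lemma right_cosetP x y : right_coset x y <-> y * x^-1 \in G0.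
Proof.
split=> [[h hG ->]|hG]; first by rewrite mulgK.
by exists (y * x^-1); rewrite ?mulgVK.
Qed.

Lemma right_coset_eq x y : right_coset x y -> right_coset y = right_coset x.
Proof.
case=> h hG ->; apply/seteqP; split=> z.
  by case=> k kG ->; exists (k * h); rewrite ?gpredM// mulgA.
case=> k kG ->; exists (k * h^-1); last by rewrite mulgA mulgVK.
by rewrite gpredM// gpredV.
Qed.

Lemma coset_reprP x : exists2 h, h \in G0 & coset_repr (right_coset x) = h * x.
Proof.
rewrite /coset_repr; case: xgetP => [y -> []h hG ->|]; first by exists h.
by move=> /(_ x) []; exists 1; rewrite ?gpred1 ?mul1g.
Qed.

Lemma right_coset_repr X : right_cosets X -> right_coset (coset_repr X) = X.
Proof.
by case=> x _ <-; apply: right_coset_eq; have [h hG ->] := coset_reprP x; exists h.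
Qed.

Lemma double_coset_inv x y : double_coset x y -> double_coset x^-1 y^-1.
Proof.
case=> h [k [hG kG ->]]; exists k^-1, h^-1; rewrite !gpredV; split=> //.
by rewrite !invgM mulgA.
Qed.

Lemma image_invK (X : set G) : ginv @` (ginv @` X) = X.
Proof.
apply/seteqP; split=> y; first by move=> [_ [z Xz <-] <-]; rewrite invgK.
by move=> Xy; exists y^-1; rewrite ?invgK//; exists y.
Qed.

Lemma image_inv_left_coset x : ginv @` left_coset x = right_coset x^-1.
Proof.
apply/seteqP; split=> y; first by move=> [_ [h hG ->] <-]; exists h^-1; rewrite ?gpredV// invgM.
move=> [h hG ->]; exists (x * h^-1); last by rewrite invgM invgK.
by exists h^-1; rewrite ?gpredV.
Qed.

Lemma image_inv_double_coset x : ginv @` double_coset x = double_coset x^-1.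
Proof.
apply/seteqP; split=> y; first by move=> [z xz <-]; apply: double_coset_inv.
by move=> /double_coset_inv; rewrite invgK => yx; exists y^-1; rewrite ?invgK.
Qed.

Lemma hecke_pair_right : hecke_pair -> forall x, exists s : seq G,
  double_coset x = \bigcup_(y in [set` s]) right_coset y.
Proof.
move=> hp x; have [s xs] := hp x^-1; exists (map ginv s).
rewrite -[x]invgK -image_inv_double_coset xs image_bigcup.
apply/seteqP; split=> z.
  move=> [y ys]; rewrite image_inv_left_coset => yz; exists y^-1 => //=.
  exact: map_f.
move=> [_ /= /mapP[y ys ->] yz]; exists y => //.
by rewrite image_inv_left_coset.
Qed.

Lemma finite_right_cosets : hecke_pair -> forall x,
  finite_set [set X | right_cosets X /\ X `<=` double_coset x].
Proof.
move=> hp x; have [s xs] := hecke_pair_right hp x.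
apply: (sub_finite_set (B := right_coset @` [set` s])); last first.
  exact: finite_image.
move=> _ [[y _ <-] yx]; have : double_coset x y.
  by apply: yx; exists 1; rewrite ?gpred1 ?mul1g.
by rewrite xs => -[z zs zy]; exists z => //; apply/esym/right_coset_eq.
Qed.

Lemma LnumE : hecke_pair -> forall x, Lnum x = Rnum x^-1.
Proof.
move=> hp x; rewrite /Lnum /Rnum.
set A := [set X | left_cosets X /\ _]; set B := [set X | right_cosets X /\ _].
have AB : A = (fun X => ginv @` X) @` B.
  apply/seteqP; split=> X.
    move=> [[y _ <-] yx]; exists (ginv @` left_coset y); last exact: image_invK.
    split; first by rewrite image_inv_left_coset; exists y^-1.
    by rewrite -image_inv_double_coset; apply: image_subset.
  move=> [_ [[y _ <-] yx] <-].
  rewrite -[y]invgK -image_inv_left_coset image_invK; split; first by exists y^-1.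
  rewrite -[left_coset _]image_invK -[x]invgK -image_inv_double_coset.
  by apply: image_subset; rewrite image_inv_left_coset invgK.
rewrite AB fset_set_image; last exact: finite_right_cosets.
rewrite card_imfset//= => X Y XY; rewrite -(image_invK X) -(image_invK Y).
by congr (_ @` _).
Qed.

End Cosets.

Section HeckeAlgebra.
Variables (R : realType) (G : groupType) (G0 : groupClosed G).
Local Notation C := R[i].
Local Notation ginv := (fun x : G => x^-1%g).
Local Notation RC := (right_cosets G0).
Implicit Types (f g : G -> C) (x y z : G).

Definition is_hecke f : Prop :=
  (forall h k x, h \in G0 -> k \in G0 -> f (h * x * k)%g = f x) /\
  (exists s : seq G, forall x, f x != 0 -> exists2 y, y \in s & double_coset G0 y x).

Definition hecke_pred : {pred G -> C} := [pred f | `[< is_hecke f >]].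

(* The summand is constant on right cosets when f and g are biinvariant, so the
   choice of representatives is immaterial. *)
Definition hecke_conv f g : G -> C := fun x =>
  \sum_(X \in RC) (f (x * (coset_repr X)^-1)%g * g (coset_repr X)).

Definition hecke_star f : G -> C := fun x => (f x^-1%g)^*.

Definition hecke_char x : G -> C := fun y => (y \in double_coset G0 x)%:R.

Lemma hecke_submod_closed : submod_closed hecke_pred.
Proof.
split.
  by apply/asboolP; split=> //; exists [::] => x; rewrite eqxx.
move=> k f g /asboolP[fi [s sP]] /asboolP[gi [t tP]]; apply/asboolP; split.
  by move=> h l x hG lG; rewrite !fctE fi ?gi.
exists (s ++ t) => x; rewrite !fctE => fgx.
have [fx|/sP[y ys yx]] := eqVneq (f x) 0; last first.
  by exists y; rewrite // mem_cat ys.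
have /tP[y yt yx] : g x != 0.
  by apply: contra_neq fgx => gx; rewrite /GRing.scale/= fx gx mulr0 addr0.
by exists y; rewrite // mem_cat yt orbT.
Qed.

Lemma hecke_char_in x : hecke_char x \in hecke_pred.
Proof.
apply/asboolP; split.
  move=> h k y hG kG; rewrite /hecke_char; congr (_%:R); congr nat_of_bool.
  apply/asboolP/asboolP.
    case=> [a [b [aG bG e]]]; exists (h^-1 * a)%g, (b * k^-1)%g.
    split; rewrite ?gpredM ?gpredV//.
    by rewrite !mulgA -(mulgA _ a) -(mulgA _ (a * x))%g -e !mulgA mulVg mul1g mulgK.
  case=> [a [b [aG bG ->]]]; exists (h * a)%g, (b * k)%g.
  by split; rewrite ?gpredM// !mulgA.
exists [:: x] => y; rewrite /hecke_char pnatr_eq0 eqb0 negbK inE => xy.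
by exists x; rewrite ?inE.
Qed.

Lemma hecke_char1E x : hecke_char 1%g x = (x \in G0)%:R.
Proof.
congr (_%:R); congr nat_of_bool; apply/idP/idP; rewrite inE.
  by case=> h [k [hG kG ->]]; rewrite mulg1 gpredM.
by move=> xG; exists x, 1%g; rewrite gpred1 !mulg1.
Qed.

Lemma hecke_rsum_translate (F : G -> C) (a : G) :
  (forall h x, h \in G0 -> F (h * x)%g = F x) ->
  \sum_(X \in RC) F (coset_repr X) = \sum_(X \in RC) F (coset_repr X * a)%g.
Proof.
move=> Fi; pose t b (X : set G) := right_coset G0 (coset_repr X * b)%g.
have tK b c X : RC X -> (b * c = 1)%g -> t c (t b X) = X.
  move=> XR bc; rewrite /t; have [h hG ->] := coset_reprP G0 (coset_repr X * b)%g.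
  rewrite -!mulgA bc mulg1 -[RHS](right_coset_repr XR).
  by apply: right_coset_eq; exists h.
rewrite (reindex_fsbig (t a) RC RC); last first.
  split=> [X XR|X Y /set_mem XR /set_mem YR e|X XR]; first by exists (coset_repr X * a)%g.
    by rewrite -(tK a a^-1%g X) ?mulgV// e tK ?mulgV.
  exists (t a^-1%g X); first by exists (coset_repr X * a^-1)%g.
  by rewrite tK ?mulVg.
apply: eq_fsbigr => X _; rewrite /t.
by have [h hG ->] := coset_reprP G0 (coset_repr X * a)%g; rewrite Fi.
Qed.

Section Invariance.
Variable f : G -> C.
Hypothesis fH : f \in hecke_pred.

Lemma hecke_invl h x : h \in G0 -> f (h * x)%g = f x.
Proof.
by move: fH => /asboolP[fi _] hG; rewrite -[(h * x)%g]mulg1 fi// gpred1.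
Qed.

Lemma hecke_invr h x : h \in G0 -> f (x * h)%g = f x.
Proof.
by move: fH => /asboolP[fi _] hG; rewrite -[x in LHS]mul1g fi// gpred1.
Qed.

Lemma hecke_invVr h x y : h \in G0 -> f (x * (h * y)^-1)%g = f (x * y^-1)%g.
Proof. by move=> hG; rewrite invgM mulgA; apply: hecke_invr; rewrite gpredV. Qed.

Hypothesis hp : hecke_pair G0.

Lemma hecke_suppr :
  exists s : seq G, forall x, f x != 0 -> exists2 y, y \in s & right_coset G0 y x.
Proof.
move: fH => /asboolP[_ [s sP]].
have /choice[r rP] x := hecke_pair_right hp x.
exists (flatten (map r s)) => x /sP[y ys]; rewrite rP => -[z zr zx].
by exists z => //; apply/flattenP; exists (r y); rewrite ?map_f.
Qed.

Lemma hecke_suppl :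
  exists s : seq G, forall x, f x != 0 -> exists2 y, y \in s & left_coset G0 y x.
Proof.
move: fH => /asboolP[_ [s sP]].
have /choice[r rP] x := hp x.
exists (flatten (map r s)) => x /sP[y ys]; rewrite rP => -[z zr zx].
by exists z => //; apply/flattenP; exists (r y); rewrite ?map_f.
Qed.

Lemma hecke_finr : finite_set [set X | RC X /\ f (coset_repr X) != 0].
Proof.
have [s sP] := hecke_suppr.
apply: (sub_finite_set (B := right_coset G0 @` [set` s])); last first.
  exact: finite_image.
move=> X [XR /sP[y ys yX]]; exists y => //.
by rewrite -(right_coset_eq yX) (right_coset_repr XR).
Qed.

Lemma hecke_finl x : finite_set [set X | RC X /\ f (x * (coset_repr X)^-1)%g != 0].
Proof.
have [s sP] := hecke_suppl.
apply: (sub_finite_set (B := (fun y => right_coset G0 (y^-1 * x)%g) @` [set` s])).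
  move=> X [XR /sP[y ys [h hG yX]]]; exists y => //.
  rewrite -[RHS](right_coset_repr XR); apply/esym/right_coset_eq.
  exists h^-1%g; rewrite ?gpredV// !mulgA -invgM -yX.
  by rewrite invgM invgK mulgVK.
exact: finite_image.
Qed.

Lemma hecke_convEr g x : hecke_conv g f x =
  \sum_(X \in [set X | RC X /\ f (coset_repr X) != 0])
    (g (x * (coset_repr X)^-1)%g * f (coset_repr X)).
Proof.
apply/esym/fsbig_widen => [X []//|X [XR /= n]].
have [->|fX] := eqVneq (f (coset_repr X)) 0; first by rewrite mulr0.
by case: n.
Qed.

Lemma hecke_convEl g x : hecke_conv f g x =
  \sum_(X \in [set X | RC X /\ f (x * (coset_repr X)^-1)%g != 0])
    (f (x * (coset_repr X)^-1)%g * g (coset_repr X)).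
Proof.
apply/esym/fsbig_widen => [X []//|X [XR /= n]].
have [->|fX] := eqVneq (f (x * (coset_repr X)^-1)%g) 0; first by rewrite mul0r.
by case: n.
Qed.

Lemma hecke_conv1l : hecke_conv (hecke_char 1%g) f = f.
Proof.
apply/funext => x; rewrite /hecke_conv.
rewrite -(fsbig_widen [set right_coset G0 x] RC).
- rewrite fsbig_set1; have [h hG ->] := coset_reprP G0 x.
  by rewrite hecke_invl// hecke_char1E invgM mulgA mulgV mul1g gpredV hG mul1r.
- by move=> _ ->; exists x.
move=> X [XR nX] /=; rewrite hecke_char1E; have [xX|_] := boolP (_ \in G0); last first.
  by rewrite mul0r.
case: nX => /=; rewrite -[LHS](right_coset_repr XR); apply/esym/right_coset_eq.
by apply/right_cosetP.
Qed.

Lemma hecke_conv1r : hecke_conv f (hecke_char 1%g) = f.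
Proof.
apply/funext => x; rewrite /hecke_conv.
rewrite -(fsbig_widen [set right_coset G0 1%g] RC).
- rewrite fsbig_set1; have [h hG ->] := coset_reprP G0 1%g.
  by rewrite mulg1 hecke_char1E hG mulr1 hecke_invr// gpredV.
- by move=> _ ->; exists 1%g.
move=> X [XR nX] /=; rewrite hecke_char1E; have [xX|_] := boolP (_ \in G0); last first.
  by rewrite mulr0.
case: nX => /=; rewrite -[LHS](right_coset_repr XR); apply: right_coset_eq.
by apply/right_cosetP; rewrite invg1 mulg1.
Qed.

Lemma hecke_star_in : hecke_star f \in hecke_pred.
Proof.
apply/asboolP; split.
  move=> h k x hG kG; rewrite /hecke_star !invgM hecke_invl ?gpredV//.
  by rewrite hecke_invr// gpredV.
move: fH => /asboolP[_ [s sP]]; exists (map ginv s) => x; rewrite conjC_eq0 => /sP.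
case=> y ys /double_coset_inv; rewrite invgK => yx.
by exists y^-1%g => //; apply: map_f.
Qed.

End Invariance.

Hypothesis hp : hecke_pair G0.

Lemma hecke_conv_in f g :
  f \in hecke_pred -> g \in hecke_pred -> hecke_conv f g \in hecke_pred.
Proof.
move=> fH gH; apply/asboolP; split.
  move=> h k x hG kG; rewrite /hecke_conv.
  rewrite (hecke_rsum_translate
    (F := fun y => f (h * x * k * y^-1)%g * g y) k); last first.
    by move=> l y lG; rewrite (hecke_invl gH)// (hecke_invVr fH).
  apply: eq_fsbigr => X _; rewrite (hecke_invr gH)//; congr (_ * _).
  by rewrite invgM mulgA mulgK -mulgA; apply: (hecke_invl fH).
have [s sP] := hecke_suppr fH hp; have [t tP] := hecke_suppr gH hp.
exists [seq (a * b)%g | a <- s, b <- t] => x fgx.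
have [X XR] : exists2 X, RC X &
    f (x * (coset_repr X)^-1)%g * g (coset_repr X) != 0.
  apply: contra_neqP fgx => /forall2NP nX; apply: fsbig1 => X XR.
  by have [//|/negP/negPn/eqP] := nX X.
rewrite mulf_eq0 negb_or => /andP[fX gX].
have [b bt [h hG bE]] := tP _ gX.
have /sP[a as' [l lG aE]] : f (x * (coset_repr X)^-1 * h)%g != 0.
  by rewrite (hecke_invr fH)//.
exists (a * b)%g; first by apply/allpairsP; exists (a, b).
exists l, 1%g; rewrite gpred1 lG mulg1 mulgA -aE bE; split=> //.
by rewrite invgM !mulgA mulgVK mulgVK.
Qed.

Lemma hecke_convDl f1 f2 g : g \in hecke_pred ->
  hecke_conv (f1 + f2) g = hecke_conv f1 g + hecke_conv f2 g.
Proof.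
move=> gH; apply/funext => x; rewrite -[RHS]/(hecke_conv f1 g x + hecke_conv f2 g x).
rewrite !(hecke_convEr g).
rewrite -fsbig_split; last exact: hecke_finr.
by apply: eq_fsbigr => X _; apply: mulrDl.
Qed.

Lemma hecke_convDr f g1 g2 : f \in hecke_pred ->
  hecke_conv f (g1 + g2) = hecke_conv f g1 + hecke_conv f g2.
Proof.
move=> fH; apply/funext => x; rewrite -[RHS]/(hecke_conv f g1 x + hecke_conv f g2 x).
rewrite !(hecke_convEl f).
rewrite -fsbig_split; last exact: hecke_finl.
by apply: eq_fsbigr => X _; apply: mulrDr.
Qed.

Lemma hecke_convZl k f g : hecke_conv (k *: f) g = k *: hecke_conv f g.
Proof.
apply/funext => x; rewrite [RHS]mulr_fsumr /hecke_conv.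
by apply: eq_fsbigr => X _; rewrite mulrA.
Qed.

Lemma hecke_convZr k f g : hecke_conv f (k *: g) = k *: hecke_conv f g.
Proof.
apply/funext => x; rewrite [RHS]mulr_fsumr /hecke_conv.
by apply: eq_fsbigr => X _; apply: mulrCA.
Qed.

Lemma hecke_convA f g h :
  f \in hecke_pred -> g \in hecke_pred -> h \in hecke_pred ->
  hecke_conv f (hecke_conv g h) = hecke_conv (hecke_conv f g) h.
Proof.
move=> fH gH hH; apply/funext => x.
rewrite (hecke_convEl f) (hecke_convEr h).
transitivity (\sum_(X \in [set X | RC X /\ h (coset_repr X) != 0])
    \sum_(Y \in [set X | RC X /\ f (x * (coset_repr X)^-1)%g != 0])
   (f (x * (coset_repr Y)^-1)%g *
    (g (coset_repr Y * (coset_repr X)^-1)%g * h (coset_repr X)))).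
  rewrite exchange_fsbig; [|exact: hecke_finr|exact: hecke_finl].
  by apply: eq_fsbigr => Y _; rewrite (hecke_convEr h) mulr_fsumr.
apply: eq_fsbigr => X _; rewrite /hecke_conv.
rewrite (hecke_rsum_translate (F := fun y =>
  f (x * (coset_repr X)^-1 * y^-1)%g * g y) (coset_repr X)^-1%g); last first.
  by move=> l y lG; rewrite (hecke_invl gH)// (hecke_invVr fH).
rewrite mulr_fsuml; under [RHS]eq_fsbigr do rewrite invgM invgK mulgA mulgVK -mulrA.
apply: fsbig_widen => [Y []//|Y [YR /= n]].
have [->|fY] := eqVneq (f (x * (coset_repr Y)^-1)%g) 0; first by rewrite mul0r.
by case: n.
Qed.

Lemma hecke_starM f g : f \in hecke_pred -> g \in hecke_pred ->
  hecke_star (hecke_conv f g) = hecke_conv (hecke_star g) (hecke_star f).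
Proof.
move=> fH gH; apply/funext => x; rewrite {1}/hecke_star.
have -> : hecke_conv f g x^-1%g =
    \sum_(X \in RC) (f (coset_repr X)^-1%g * g (coset_repr X * x^-1)%g).
  rewrite /hecke_conv (hecke_rsum_translate (F := fun y =>
    f (x^-1 * y^-1)%g * g y) x^-1%g); last first.
    by move=> l y lG; rewrite (hecke_invl gH)// (hecke_invVr fH).
  by apply: eq_fsbigr => X _; rewrite invgM invgK mulgA mulVg mul1g.
have ffin := hecke_finl fH hp 1%g; rewrite hecke_convEr.
pose P := [set X | RC X /\ f (1 * (coset_repr X)^-1)%g != 0].
have PE : [set X | RC X /\ hecke_star f (coset_repr X) != 0] = P.
  by apply/seteqP; split=> X; rewrite /P /= conjC_eq0 mul1g.
rewrite PE -(fsbig_widen P RC) => [|X []//|X [XR /= n]]; last first.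
  have [->|fX] := eqVneq (f (coset_repr X)^-1%g) 0; first by rewrite mul0r.
  by case: n; split=> //; rewrite mul1g.
rewrite !fsbig_finite// rmorph_sum; apply: eq_bigr => X _.
by rewrite rmorphM mulrC /hecke_star invgM invgK.
Qed.

End HeckeAlgebra.

Record hecke_alg (R : realType) (G : groupType) (G0 : groupClosed G)
    (hp : hecke_pair G0) := Hecke {
  hecke_fun :> G -> R[i];
  _ : hecke_fun \in @hecke_pred R G G0 }.

Section HeckeAlgInstances.
Variables (R : realType) (G : groupType) (G0 : groupClosed G).

HB.instance Definition _ := GRing.isSubmodClosed.Build R[i] (G -> R[i])
  (@hecke_pred R G G0) (@hecke_submod_closed R G G0).

Variable hp : hecke_pair G0.
Local Notation H := (hecke_alg R hp).

HB.instance Definition _ := [isSub for @hecke_fun R G G0 hp].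
HB.instance Definition _ := [Choice of H by <:].
HB.instance Definition _ := [SubChoice_isSubLmodule of H by <:].

Definition hecke_class (x : G) : H := Hecke hp (@hecke_char_in R G G0 x).

Definition hecke_mul (f g : H) : H := Hecke hp (hecke_conv_in hp (valP f) (valP g)).

Definition hecke_adj (f : H) : H := Hecke hp (hecke_star_in (valP f)).

Fact hecke_mulA : associative hecke_mul.
Proof. by move=> f g h; apply: val_inj; exact: (hecke_convA hp (valP f) (valP g) (valP h)). Qed.

Fact hecke_mul1l : left_id (hecke_class 1%g) hecke_mul.
Proof. by move=> f; apply: val_inj; exact: (hecke_conv1l (valP f)). Qed.

Fact hecke_mul1r : right_id (hecke_class 1%g) hecke_mul.
Proof. by move=> f; apply: val_inj; exact: (hecke_conv1r (valP f)). Qed.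

Fact hecke_mulDl : left_distributive hecke_mul +%R.
Proof. by move=> f g h; apply: val_inj; exact: (hecke_convDl hp _ _ (valP h)). Qed.

Fact hecke_mulDr : right_distributive hecke_mul +%R.
Proof. by move=> f g h; apply: val_inj; exact: (hecke_convDr hp _ _ (valP f)). Qed.

Fact hecke_one_neq0 : hecke_class 1%g != 0.
Proof.
apply/eqP => /(congr1 (fun f : H => f 1%g)) /= /eqP.
by rewrite hecke_char1E gpred1 oner_eq0.
Qed.

HB.instance Definition _ := GRing.Zmodule_isNzRing.Build H hecke_mulA
  hecke_mul1l hecke_mul1r hecke_mulDl hecke_mulDr hecke_one_neq0.

Fact hecke_scaleAl (k : R[i]) (f g : H) : k *: (f * g) = (k *: f) * g.
Proof. by apply: val_inj; exact/esym/hecke_convZl. Qed.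

Fact hecke_scaleAr (k : R[i]) (f g : H) : k *: (f * g) = f * (k *: g).
Proof. by apply: val_inj; exact/esym/hecke_convZr. Qed.

HB.instance Definition _ := GRing.Lmodule_isLalgebra.Build R[i] H hecke_scaleAl.
HB.instance Definition _ := GRing.Lalgebra_isAlgebra.Build R[i] H hecke_scaleAr.

Fact hecke_adjD : {morph hecke_adj : f g / f + g}.
Proof. by move=> f g; apply/val_inj/funext => x; apply: rmorphD. Qed.

Fact hecke_adjZ (k : R[i]) (f : H) : hecke_adj (k *: f) = k^* *: hecke_adj f.
Proof. by apply/val_inj/funext => x; apply: rmorphM. Qed.

Fact hecke_adjM (f g : H) : hecke_adj (f * g) = hecke_adj g * hecke_adj f.
Proof. by apply: val_inj; exact: (hecke_starM hp (valP f) (valP g)). Qed.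

Fact hecke_adjK : involutive hecke_adj.
Proof.
by move=> f; apply/val_inj/funext => x; rewrite /= /hecke_star invgK conjCK.
Qed.

HB.instance Definition _ := isStarAlgebra.Build R H
  hecke_adjD hecke_adjZ hecke_adjM hecke_adjK.

Definition hecke_W (s : G) : H :=
  ((Num.sqrt (Rnum G0 s)%:R : R)^-1)%:C%C *: hecke_class s.

End HeckeAlgInstances.

(* Main.v *)
Require Import Defs.
From HB Require Import structures.
From mathcomp Require Import all_boot all_order all_algebra.
From mathcomp Require Import finmap generic_quotient ring lra.
From mathcomp Require Import boolp classical_sets functions cardinality fsbigop.
From mathcomp Require Import reals ereal topology normedtype sequences.
From mathcomp Require Import complex sesquilinear.

Set Implicit Arguments.
Unset Strict Implicit.
Unset Printing Implicit Defensive.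

Import Order.TTheory GRing.Theory Num.Theory.
Import numFieldNormedType.Exports.

Local Open Scope classical_set_scope.
Local Open Scope ring_scope.

(** The basis. If L(s) = 1 the double coset of s is the single left coset s G0, so
    the product [g] [s] is a nonnegative multiple of [g s] (class_mulr). Taking
    g = t^-1, the element W_t^* W_s is a nonnegative multiple of [t^-1 s]. The
    multiple is found without counting. The sum of f over right cosets, and its
    analogue for left cosets, are multiplicative functionals (degRM, degLM) with
    values R(x) and L(x) at [x]; the product of the two is 1 at W_s and at its star,
    hence at W_t^* W_s, and this forces W_t^* W_s = (R(x) L(x))^(-1/2) [x] with
    x = t^-1 s. So the W_t^* W_s are exactly the normalized double cosets
    hecke_unit x, one for each double coset since every x is of the form t^-1 s,
    and they form a basis. The same argument gives W_s W_t = W_(s t) and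
    W_s^* W_s = 1.

    The enveloping algebra. In any representation the isometries W_s and their stars
    act by contractions, so each basis element has norm at most 1 and the universal
    seminorm is finite. It is a C*-seminorm, and it does not vanish at 1: the modular
    function L / R is multiplicative on the group, as one sees by comparing the two
    degrees of both sides of [g] [s] = c [g s], and twisting the degree by its square
    root gives a one-dimensional representation hecke_chi with value 1 at each
    hecke_unit x. The enveloping algebra is the completion by Cauchy sequences.

    The quotient. By universality the W_s induce a morphism from the universal algebra
    of isometric representations, whose range contains the dense image of the Hecke
    algebra. A morphism phi of C*-algebras with dense range is surjective
    (dense_range_surj), for the following reason, which needs neither spectra nor
    quotients. If k is self-adjoint then 2 k / (1 + k^2), the imaginary part of a
    Cayley transform, has norm at most 1 (half_tangent), and every self-adjoint b
    with |b| < 1 has this form (half_tangent_exists). This implies that phi is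
    contractive; and approximating k, without any control of norms, by images of
    self-adjoint elements approximates b by images of elements of the unit ball
    (approx_lift_selfadj). Successive approximation then gives a preimage. *)

(** * Involutions and C*-seminorms *)

Section StarAlgebraLemmas.
Variables (R : realType) (A : starAlgType R).
Implicit Types a b : A.

Lemma star0 : star (0 : A) = 0.
Proof. by have := starZ 0 (0 : A); rewrite scale0r rmorph0 scale0r. Qed.

Lemma starN a : star (- a) = - star a.
Proof. by rewrite -scaleN1r starZ rmorphN1 scaleN1r. Qed.

Lemma starB a b : star (a - b) = star a - star b.
Proof. by rewrite starD starN. Qed.

Lemma star1 : star (1 : A) = 1.
Proof. by rewrite -[LHS]mulr1 -{2}(starK (1 : A)) -starM mulr1 starK. Qed.

Lemma scale_half a : (2^-1)%:C%C *: (a + a) = a.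
Proof.
have e : (2^-1)%:C%C + (2^-1)%:C%C = 1 :> R[i].
  by rewrite -rmorphD -(rmorph1 (real_complex R)); congr _%:C%C; field.
by rewrite scalerDr -scalerDl e scale1r.
Qed.

End StarAlgebraLemmas.

Section ComplexLemmas.
Variable R : realType.
Local Notation C := R[i].

Lemma Re_norm_real (k : R) : complex.Re `|k%:C%C : C| = `|k|.
Proof. by rewrite normc_def /= expr0n addr0 sqrtr_sqr. Qed.

Lemma Re_norm_i : complex.Re `|'i%C : C| = 1.
Proof. by rewrite normc_def /= expr0n add0r expr1n sqrtr1. Qed.

Lemma conjC_i : ('i%C : C)^* = - 'i%C.
Proof. by rewrite complexiE conjCi. Qed.

Lemma conjC_realC (k : R) : (k%:C%C : C)^* = k%:C%C.
Proof. exact: conjc_real. Qed.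

Lemma norm_real (V : normedZmodType C) (x : V) : (complex.Re `|x|)%:C%C = `|x|.
Proof. by rewrite RRe_real// normr_real. Qed.

Lemma realCD (x y : R) : (x + y)%:C%C = x%:C%C + y%:C%C :> C.
Proof. exact: rmorphD. Qed.

Lemma realCM (x y : R) : (x * y)%:C%C = x%:C%C * y%:C%C :> C.
Proof. exact: rmorphM. Qed.

End ComplexLemmas.

(** A seminorm that is nonzero at 1, so that the completion is not the zero
    algebra; the norm of a C*-algebra and the universal seminorm of a star-algebra
    are both instances. *)
Record cstar_seminorm (R : realType) (A : starAlgType R) := CstarSeminorm {
  seminorm :> A -> R;
  seminormD : forall a b, seminorm (a + b) <= seminorm a + seminorm b;
  seminormZ : forall (k : R[i]) a, seminorm (k *: a) = complex.Re `|k| * seminorm a;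
  seminormM : forall a b, seminorm (a * b) <= seminorm a * seminorm b;
  seminorm_star : forall a, seminorm (star a * a) = seminorm a ^+ 2;
  seminorm1_neq0 : seminorm 1 != 0 }.

Section SeminormLemmas.
Variables (R : realType) (A : starAlgType R) (p : cstar_seminorm A).
Implicit Types a b c : A.

Lemma seminormZr (k : R) a : p (k%:C%C *: a) = `|k| * p a.
Proof. by rewrite seminormZ Re_norm_real. Qed.

Lemma seminormZi a : p ('i%C *: a) = p a.
Proof. by rewrite seminormZ Re_norm_i mul1r. Qed.

Lemma seminorm0 : p 0 = 0.
Proof. by rewrite -(scale0r 0) seminormZ normr0 mul0r. Qed.

Lemma seminormN a : p (- a) = p a.
Proof. by rewrite -scaleN1r seminormZ normrN1 mul1r. Qed.

Lemma seminorm_ge0 a : 0 <= p a.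
Proof. by have := seminormD p a (- a); rewrite subrr seminorm0 seminormN; lra. Qed.

Lemma seminormB a b : p (a - b) <= p a + p b.
Proof. by rewrite -[p b]seminormN; apply: seminormD. Qed.

Lemma seminorm_distC a b : p (a - b) = p (b - a).
Proof. by rewrite -seminormN opprB. Qed.

Lemma seminorm_split b a c : p (a - c) <= p (a - b) + p (b - c).
Proof. by rewrite -[a - c](subrKA b); apply: seminormD. Qed.

Lemma seminorm_starE a : p (star a) = p a.
Proof.
have le x : p x <= p (star x).
  have [->|/eqP n0] := eqVneq (p x) 0; first exact: seminorm_ge0.
  have := seminormM p (star x) x; rewrite seminorm_star expr2.
  by rewrite ler_pM2r// lt_neqAle seminorm_ge0 eq_sym andbT; apply/eqP.
by apply/le_anti; rewrite le -{2}(starK a) le.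
Qed.

Lemma seminorm1 : p 1 = 1.
Proof.
have := seminorm_star p 1; rewrite star1 mulr1 => /eqP.
rewrite -subr_eq0 expr2 -{1}[p 1]mulr1 -mulrBr mulf_eq0 (negPf (seminorm1_neq0 p)).
by rewrite subr_eq0 => /eqP.
Qed.

End SeminormLemmas.

(** * Elementary theory of C*-algebras *)

Section CstarNorm.
Variables (R : realType) (A : cstarAlgType R).
Implicit Types a b x : A.

Lemma cnorm1_neq0 : cnorm (1 : A) != 0.
Proof. by apply/eqP => /cnorm_eq0/eqP; rewrite oner_eq0. Qed.

Definition cnorm_seminorm : cstar_seminorm A :=
  CstarSeminorm cnormD cnormZ cnormM cnorm_star cnorm1_neq0.
Local Notation p := cnorm_seminorm.

Definition cnormZr : forall (k : R) a, cnorm (k%:C%C *: a) = `|k| * cnorm a :=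
  seminormZr p.
Definition cnormZi : forall a, cnorm ('i%C *: a) = cnorm a := seminormZi p.
Definition cnorm0 : cnorm (0 : A) = 0 := seminorm0 p.
Definition cnormN : forall a, cnorm (- a) = cnorm a := seminormN p.
Definition cnorm_ge0 : forall a, 0 <= cnorm a := seminorm_ge0 p.
Definition cnormB : forall a b, cnorm (a - b) <= cnorm a + cnorm b := seminormB p.
Definition cnorm_distC : forall a b, cnorm (a - b) = cnorm (b - a) :=
  seminorm_distC p.
Definition cnorm_split : forall b a c : A,
  cnorm (a - c) <= cnorm (a - b) + cnorm (b - c) := seminorm_split p.
Definition cnorm_starE : forall a, cnorm (star a) = cnorm a := seminorm_starE p.
Definition cnorm1 : cnorm (1 : A) = 1 := seminorm1 p.

Lemma cnorm_le_eps a : (forall e : R, 0 < e -> cnorm a <= e) -> a = 0.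
Proof.
move=> ae; apply: cnorm_eq0; apply/le_anti; rewrite cnorm_ge0 andbT.
by apply/ler_addgt0Pr => e e0; rewrite add0r ae.
Qed.

Lemma expr_lt_eps (q e : R) : 0 <= q -> q < 1 -> 0 < e ->
  exists N : nat, forall n, (N <= n)%N -> q ^+ n < e.
Proof.
move=> q0 q1 e0.
have /cvgrPdist_lt/(_ e e0)[N _ NP] : q ^+ n @[n --> \oo] --> (0 : R).
  by apply: cvg_expr; rewrite ger0_norm.
exists N => n /NP; rewrite /= sub0r normrN ger0_norm//.
exact: exprn_ge0.
Qed.

(** Banach's fixed point theorem, on the closed ball of radius r about 0. It yields
    both the inverses and the solutions of quadratic equations needed below, in
    place of power series and functional calculus. *)
Lemma cnorm_fixpoint (T : A -> A) (r q : R) : 0 <= r -> 0 <= q -> q < 1 ->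
  (forall x, cnorm x <= r -> cnorm (T x) <= r) ->
  (forall x y, cnorm x <= r -> cnorm y <= r ->
     cnorm (T x - T y) <= q * cnorm (x - y)) ->
  exists x, cnorm x <= r /\ T x = x.
Proof.
move=> r0 q0 q1 Tr Tq; pose u n := iter n T 0.
have ur n : cnorm (u n) <= r by elim: n => [|n]; rewrite /u ?cnorm0//; apply: Tr.
(* Both terms are the n-th iterates of points of the ball, u k and u 0 = 0. *)
have uq n k : cnorm (u (n + k)%N - u n) <= q ^+ n * r.
  elim: n => [|n IH]; first by rewrite subr0 expr0 mul1r ur.
  rewrite addSn /= exprS -mulrA; apply: le_trans (Tq _ _ (ur _) (ur _)) _.
  exact: ler_wpM2l.
have [|x xP] := @cnorm_complete R A u.
  move=> e e0; have [|N NP] := expr_lt_eps q0 q1 (e := e / (2 * (r + 1))).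
    by rewrite divr_gt0//; lra.
  have qr : q ^+ N * (2 * (r + 1)) < e.
    by rewrite -ltr_pdivlMr ?NP//; lra.
  have q0N := exprn_ge0 N q0.
  exists N => m n /subnKC <- /subnKC <-.
  apply: le_lt_trans (cnorm_split (u N) _ _) _; rewrite (cnorm_distC (u N)).
  have := uq N (m - N)%N; have := uq N (n - N)%N; nra.
have xr : cnorm x <= r.
  apply/ler_addgt0Pr => e /xP[N /(_ N (leqnn _)) uNx].
  have := cnormB (u N) (u N - x); rewrite subKr; have := ur N; lra.
exists x; split=> //; apply/eqP; rewrite -subr_eq0; apply/eqP/cnorm_le_eps => e e0.
have [|N NP] := xP (e / 2); first lra.
have := NP N (leqnn _); have := NP _ (leqnSn N).
have := cnorm_split (u N.+1) (T x) x.
have := Tq x (u N) xr (ur _); rewrite (cnorm_distC x) -[T (u N)]/(u N.+1).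
have := cnorm_ge0 (u N - x); nra.
Qed.

(** The fixed points of x |-> 1 + a x and of x |-> 1 + x a are a right and a left
    inverse of 1 - a, hence coincide. *)
Lemma cnorm_neumann a : cnorm a < 1 -> exists z, z * (1 - a) = 1 /\ (1 - a) * z = 1.
Proof.
move=> a1; have a0 := cnorm_ge0 a; set r : R := (1 - cnorm a)^-1.
have a1' : 0 < 1 - cnorm a by lra.
have r0 : 0 <= r by rewrite invr_ge0 ltW.
have rE : 1 + cnorm a * r = r.
  by have := mulfV (lt0r_neq0 a1'); rewrite -/r mulrBl mul1r; lra.
have [|x y _ _|z [_ zE]] := @cnorm_fixpoint (fun x => 1 + a * x) r _ r0 a0 a1.
- move=> x xr; apply: le_trans (cnormD _ _) _; rewrite cnorm1 -[leRHS]rE.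
  by rewrite lerD2l; apply: le_trans (cnormM _ _) _; apply: ler_wpM2l.
- by rewrite /= opprD addrACA subrr add0r -mulrBr; apply: cnormM.
have [|x y _ _|w [_ wE]] := @cnorm_fixpoint (fun x => 1 + x * a) r _ r0 a0 a1.
- move=> x xr; apply: le_trans (cnormD _ _) _; rewrite cnorm1 -[leRHS]rE.
  by rewrite lerD2l; apply: le_trans (cnormM _ _) _; rewrite mulrC; apply: ler_wpM2l.
- by rewrite /= opprD addrACA subrr add0r -mulrBl mulrC; apply: cnormM.
have zR : (1 - a) * z = 1 by rewrite mulrBl mul1r -{1}zE addrK.
have wL : w * (1 - a) = 1 by rewrite mulrBr mulr1 -{1}wE addrK.
by exists z; split=> //; rewrite -[z]mul1r -{1}wL -mulrA zR mulr1.
Qed.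

End CstarNorm.

Section Cayley.
Variables (R : realType) (A : cstarAlgType R).
Implicit Types (a b k x : A) (e : R).

(** For t = |k|^2 the C*-identity gives |t + i k|^2 = |t^2 + k^2| < (1 + t)^2, so
    that 1 - i k = (1 + t) - (t + i k) is a small perturbation of 1 + t. This is
    the reality of the spectrum of k, without spectra. *)
Lemma sub_scalei_inv k : star k = k ->
  exists z, z * (1 - 'i%C *: k) = 1 /\ (1 - 'i%C *: k) * z = 1.
Proof.
move=> ks; have [t tE] : exists t : R, t = cnorm k ^+ 2 by exists (cnorm k ^+ 2).
have t0 : 0 <= t by rewrite tE exprn_ge0// cnorm_ge0.
pose w : A := t%:C%C%:A + 'i%C *: k.
have ws : star w * w = (t ^+ 2)%:C%C%:A + k * k.
  rewrite /w starD !starZ star1 ks conjC_realC conjC_i scaleNr.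
  set T := t%:C%C%:A; set K := 'i%C *: k.
  have TK : T * K = K * T by rewrite /T mulr_algl mulr_algr.
  have KK : K * K = - (k * k).
    by rewrite -scalerAl -scalerAr scalerA -expr2 sqr_i scaleN1r.
  have TT : T * T = (t ^+ 2)%:C%C%:A.
    by rewrite mulr_algl scalerA -rmorphM -expr2.
  by rewrite mulrBl !mulrDr TK KK TT opprD opprK addrA addrK.
have w2 : cnorm w ^+ 2 <= t ^+ 2 + t.
  rewrite -cnorm_star ws; apply: le_trans (cnormD _ _) _.
  rewrite cnormZr cnorm1 mulr1 ger0_norm ?exprn_ge0// lerD2l.
  by rewrite tE expr2 cnormM.
have t1 : 1 + t != 0 by apply: lt0r_neq0; lra.
have wt : cnorm w < 1 + t.
  rewrite -ltr_sqr ?nnegrE ?cnorm_ge0 ?addr_ge0//; apply: le_lt_trans w2 _.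
  by rewrite -subr_gt0 (_ : _ - _ = 1 + t); [lra|ring].
pose a := ((1 + t)^-1)%:C%C *: w.
have [|z [zl zr]] := @cnorm_neumann R A a.
  by rewrite cnormZr ger0_norm ?invr_ge0 1?mulrC ?ltr_pdivrMr ?mul1r//; lra.
have aE : 1 - 'i%C *: k = (1 + t)%:C%C *: (1 - a).
  rewrite scalerBr scalerA -rmorphM divff// scale1r /w rmorphD scalerDl scale1r.
  by rewrite opprD addrA addrK.
exists ((1 + t)^-1%:C%C *: z); rewrite aE -!scalerAl -!scalerAr !scalerA zl zr.
by rewrite -!rmorphM mulVf// mulfV// scale1r.
Qed.

(** The element s = 2 k / (1 + k^2) is the imaginary part of the Cayley transform
    (1 + i k) / (1 - i k), which is unitary; hence the bound on its norm. For
    k = tan (t / 2) it is sin t. *)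
Lemma half_tangent k : star k = k -> exists s E,
  [/\ cnorm s <= 1, s * (1 + k * k) = 2%:R *: k & (1 + k * k) * E = 1].
Proof.
move=> ks; have [z [zl zr]] := sub_scalei_inv ks.
set p := 1 - 'i%C *: k in zl zr; set q := 1 + 'i%C *: k.
have ps : star p = q.
  by rewrite /p starB starZ star1 ks conjC_i scaleNr opprK.
have iik : 'i%C *: k * ('i%C *: k) = - (k * k).
  by rewrite -scalerAl -scalerAr scalerA -expr2 sqr_i scaleN1r.
have pq : p * q = 1 + k * k.
  by rewrite /p /q mulrBl mul1r mulrDr mulr1 iik opprD opprK addrA addrK.
have qp : q * p = 1 + k * k.
  by rewrite /p /q mulrBr mulr1 mulrDl mul1r iik opprD opprK addrA addrK.
have qzs : q * star z = 1 by rewrite -ps -starM zl star1.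
have zsq : star z * q = 1 by rewrite -ps -starM zr star1.
pose c := q * z.
have cs : star c = star z * p by rewrite /c starM -ps starK.
have cc : star c * c = 1.
  by rewrite cs /c mulrA -(mulrA _ p) pq -qp mulrA zsq mul1r zr.
have c1 : cnorm c = 1.
  have := cnorm_star c; rewrite cc cnorm1 => /esym/eqP.
  by rewrite sqrf_eq1 => /orP[/eqP//|/eqP c1]; have := cnorm_ge0 c; lra.
have c1' : cnorm (star c) = 1 by rewrite cnorm_starE.
(* The imaginary part of c, with 1 / i written as - i. *)
exists ((2^-1)%:C%C *: - ('i%C *: (c - star c))), (z * star z); split.
- rewrite cnormZr cnormN cnormZi; have := cnormB c (star c).
  by rewrite c1 c1' ger0_norm ?invr_ge0//; lra.
- rewrite -scalerAl mulNr -scalerAl mulrBl -{1}pq -qp cs /c.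
  rewrite -(mulrA q) (mulrA z) zl mul1r -(mulrA (star z)) (mulrA p) pq -qp.
  rewrite -!mulrA (mulrA (star z)) zsq mul1r.
  have -> : q * q - p * p = (4%:R * 'i%C) *: k.
    have qBp : q - p = 'i%C *: k *+ 2.
      by rewrite /q /p opprB addrC addrA subrK -mulr2n.
    have sqB (u v : A) : u * u - v * v = (u - v) * u + v * (u - v).
      by rewrite mulrBl mulrBr addrA subrK.
    rewrite sqB qBp (mulrnAl ('i%C *: k)) (mulrnAr p) -mulrnDl mulrDr mulrBl mulr1 mul1r.
    by rewrite addrACA subrr addr0 -mulr2n -mulrnA -scaler_nat scalerA.
  rewrite scalerA -scaleNr scalerA; congr (_ *: k).
  rewrite mulrCA -expr2 sqr_i mulrN1 opprK.
  rewrite -[4%:R](rmorph_nat (real_complex R)) -rmorphM.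
  by rewrite -[RHS](rmorph_nat (real_complex R)); congr _%:C%C; field.
- by rewrite -qp -mulrA (mulrA p) zr mul1r qzs.
Qed.

Lemma half_tangent_le1 b k : star k = k -> b * (1 + k * k) = 2%:R *: k ->
  cnorm b <= 1.
Proof.
move=> ks bk; have [s [E [s1 sk kE]]] := half_tangent ks.
by rewrite -[b]mulr1 -kE mulrA bk -sk -mulrA kE mulr1.
Qed.

(** Conversely k = tan (t / 2) is recovered from b = sin t as the solution of
    k = (b + k b k) / 2 in the unit ball, where the right-hand side is a contraction
    of ratio |b|. The symmetric form k b k makes the star of a solution a solution,
    so that k is self-adjoint by uniqueness. *)
Lemma half_tangent_exists b : star b = b -> cnorm b < 1 ->
  exists k, star k = k /\ b * (1 + k * k) = 2%:R *: k.
Proof.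
move=> bs b1; have b0 := cnorm_ge0 b.
pose T x : A := (2^-1)%:C%C *: (b + x * b * x).
have nT (x : A) : cnorm ((2^-1)%:C%C *: x) = cnorm x / 2.
  by rewrite cnormZr ger0_norm ?invr_ge0// mulrC.
have M3 x y z' : cnorm (x * y * z') <= cnorm x * cnorm y * cnorm z'.
  apply: le_trans (cnormM _ _) _; apply: ler_wpM2r (cnormM _ _).
  exact: cnorm_ge0.
have TB x y : cnorm x <= 1 -> cnorm y <= 1 ->
    cnorm (T x - T y) <= cnorm b * cnorm (x - y).
  move=> x1 y1; rewrite -scalerBr nT opprD addrACA subrr add0r.
  have -> : x * b * x - y * b * y = (x - y) * b * x + y * b * (x - y).
    by rewrite mulrBr mulrBl mulrBl addrA subrK.
  have := cnormD ((x - y) * b * x) (y * b * (x - y)).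
  have := M3 (x - y) b x; have := M3 y b (x - y).
  have := cnorm_ge0 (x - y); have := cnorm_ge0 x; have := cnorm_ge0 y.
  set d := cnorm (x - y); move=> y0 x0 d0 H1 H2 H3.
  have : d * cnorm b * cnorm x <= d * cnorm b by rewrite ler_piMr// mulr_ge0.
  have : cnorm y * cnorm b * d <= cnorm b * d.
    by rewrite -mulrA ler_piMl// mulr_ge0.
  by rewrite (mulrC d) ler_pdivrMr//; lra.
have [|//|k [k1 kE]] := @cnorm_fixpoint R A T 1 (cnorm b) ler01 b0 b1.
  move=> x x1; rewrite nT; have := cnormD b (x * b * x); have := M3 x b x.
  have x0 := cnorm_ge0 x.
  have : cnorm x * cnorm b * cnorm x <= cnorm b.
    by rewrite mulrAC ler_piMl// -expr2 exprn_ile1.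
  by rewrite ler_pdivrMr//; lra.
have ks : star k = k.
  have ksE : T (star k) = star k.
    rewrite -{2}kE /T starZ conjC_realC starD !starM bs mulrA; congr (_ *: (_ + _)).
  have : cnorm (T (star k) - T k) <= cnorm b * cnorm (star k - k).
    by apply: TB; rewrite ?cnorm_starE.
  rewrite ksE kE => H; apply/eqP; rewrite -subr_eq0; apply/eqP/cnorm_eq0.
  have := cnorm_ge0 (star k - k); nra.
have k2 : 2%:R *: k = b + k * b * k.
  rewrite -{1}kE /T scalerA -(rmorph_nat (real_complex R)) -rmorphM divff ?scale1r//.
exists k; split=> //; rewrite k2 mulrDr mulr1; congr (_ + _).
(* The commutator d of k and b satisfies 2 d = k b d + d b k, so |d| <= |b| |d|. *)
rewrite mulrA; congr (_ * k); apply/esym/eqP; rewrite -subr_eq0; apply/eqP/cnorm_eq0.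
set d := k * b - b * k.
have dE : 2%:R *: d = k * b * d + d * (b * k).
  rewrite /d scalerBr scalerAl scalerAr k2 mulrDl mulrDr mulrBr mulrBl.
  rewrite !mulrA opprD addrACA subrr add0r addrA subrK //.
have : cnorm (2%:R *: d) <= 2 * cnorm b * cnorm d.
  rewrite dE; apply: le_trans (cnormD _ _) _.
  have d0 := cnorm_ge0 d; have k0 := cnorm_ge0 k.
  have kb : cnorm (k * b) <= cnorm b.
    by apply: le_trans (cnormM _ _) _; rewrite ler_piMl.
  have bk : cnorm (b * k) <= cnorm b.
    by apply: le_trans (cnormM _ _) _; rewrite ler_piMr.
  have := cnormM (k * b) d; have := cnormM d (b * k).
  nra.
rewrite -[2%:R](rmorph_nat (real_complex R)) cnormZr ger0_norm// => H.
have := cnorm_ge0 d; nra.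
Qed.

End Cayley.

(** * Morphisms of C*-algebras with dense range *)

Section StarMorphism.
Variables (R : realType) (U B : cstarAlgType R) (phi : {lrmorphism U -> B}).
Hypothesis phiS : star_preserving phi.

Lemma half_tangent_morph (b k : U) : b * (1 + k * k) = 2%:R *: k ->
  phi b * (1 + phi k * phi k) = 2%:R *: phi k.
Proof. by move=> /(congr1 phi); rewrite linearZ !rmorphM rmorphD rmorph1 rmorphM. Qed.

(** A self-adjoint h with |h| < 1 has the form 2 k / (1 + k^2) with k self-adjoint;
    this form is preserved by phi, and bounds the norm of the image by 1. *)
Lemma star_morph_le (a : U) : cnorm (phi a) <= cnorm a.
Proof.
have sa (h : U) : star h = h -> cnorm h < 1 -> cnorm (phi h) <= 1.
  move=> hs h1; have [k [ks hk]] := half_tangent_exists hs h1.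
  by apply: half_tangent_le1 (half_tangent_morph hk); rewrite -phiS ks.
have sb (h : U) : star h = h -> cnorm (phi h) <= cnorm h.
  move=> hs; apply/ler_addgt0Pr => e e0.
  have M0 : 0 < cnorm h + e by rewrite ltr_wpDl// cnorm_ge0.
  have M0' := ltW M0.
  have := sa (((cnorm h + e)^-1)%:C%C *: h).
  rewrite starZ conjC_realC hs linearZ !cnormZr ger0_norm ?invr_ge0 ?M0'//.
  rewrite !(mulrC _^-1) ltr_pdivrMr// ler_pdivrMr// !mul1r; apply=> //.
  by rewrite ltrDl.
rewrite -ler_sqr ?nnegrE ?cnorm_ge0// -!cnorm_star -phiS -rmorphM; apply: sb.
by rewrite starM starK.
Qed.

Hypothesis phiD : cclosure (range phi) = setT.

Lemma dense_range (b : B) (e : R) : 0 < e -> exists a, cnorm (b - phi a) < e.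
Proof.
move=> e0; have : cclosure (range phi) b by rewrite phiD.
by move=> /(_ e e0)[_ [a _ <-] ba]; exists a.
Qed.

(** A self-adjoint element of the open unit ball is approximated by images of
    the unit ball: its half tangent k can be approximated by images of self-adjoint
    elements of arbitrary norm, and 2 k / (1 + k^2) lifts with norm at most 1. *)
Lemma approx_lift_selfadj (b : B) (e : R) : star b = b -> cnorm b < 1 -> 0 < e ->
  exists a, cnorm a <= 1 /\ cnorm (b - phi a) < e.
Proof.
move=> bs b1 e0; have [k [ks bk]] := half_tangent_exists bs b1.
have [s [E [s1 sk kE]]] := half_tangent ks.
(* M is a Lipschitz constant of k |-> 2 k / (1 + k^2) at k, valid at distance
   at most 1; E is the inverse of 1 + k^2. *)
pose M := (2 * cnorm k + 3) * (cnorm E + 1).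
have k0 := cnorm_ge0 k; have E0 := cnorm_ge0 E.
have M0 : 0 < M by apply: mulr_gt0; lra.
pose d := Num.min 1 (e / (2 * M)).
have d0 : 0 < d by rewrite lt_min ltr01 divr_gt0//; lra.
have d1 : d <= 1 by rewrite ge_min lexx.
have de : M * d < e.
  have : d <= e / (2 * M) by rewrite ge_min lexx orbT.
  by rewrite ler_pdivlMr; [lra|lra].
have [a0 a0k] := dense_range k d0.
pose l := (2^-1)%:C%C *: (a0 + star a0).
have ls : star l = l by rewrite starZ conjC_realC starD starK addrC.
have lk : cnorm (k - phi l) < d.
  have -> : k - phi l = (2^-1)%:C%C *: ((k - phi a0) + star (k - phi a0)).
    rewrite starB ks addrACA -opprD scalerBr scale_half.
    by rewrite -phiS -raddfD linearZ.
  rewrite cnormZr ger0_norm ?invr_ge0//.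
  have := cnormD (k - phi a0) (star (k - phi a0)); rewrite cnorm_starE; lra.
have [t [F [t1 tl lF]]] := half_tangent ls.
exists t; split=> //.
have tl' := half_tangent_morph tl.
set g := phi t in tl' *; set m := phi l in tl' lk *.
have g1 : cnorm g <= 1.
  by apply: half_tangent_le1 tl'; rewrite -phiS ls.
have -> : b - g = (2%:R *: (k - m) + g * ((m - k) * m + k * (m - k))) * E.
  rewrite -[LHS]mulr1 -kE mulrA; congr (_ * E).
  have -> : (m - k) * m + k * (m - k) = (1 + m * m) - (1 + k * k).
    by rewrite mulrBl mulrBr addrA subrK opprD addrACA subrr add0r.
  by rewrite mulrBr tl' mulrBl bk scalerBr addrA subrK.
have H (x y : B) : cnorm (x * y) <= cnorm x * cnorm y := cnormM x y.
apply: le_lt_trans de; apply: le_trans (H _ _) _.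
have mk : cnorm (m - k) <= d by rewrite cnorm_distC ltW.
have m1 : cnorm m <= cnorm k + 1.
  by have := cnormD k (m - k); rewrite addrC subrK; lra.
have m0 := cnorm_ge0 m; have g0 := cnorm_ge0 g; have mk0 := cnorm_ge0 (m - k).
have h1 : cnorm ((m - k) * m + k * (m - k)) <= (2 * cnorm k + 1) * d.
  have := cnormD ((m - k) * m) (k * (m - k)).
  have := H (m - k) m; have := H k (m - k); nra.
have h2 : cnorm (g * ((m - k) * m + k * (m - k))) <= (2 * cnorm k + 1) * d.
  apply: le_trans (H _ _) _; apply: le_trans h1.
  by rewrite ler_piMl// cnorm_ge0.
have h3 : cnorm (2%:R *: (k - m)) <= 2 * d.
  rewrite -[2%:R](rmorph_nat (real_complex R)) cnormZr ger0_norm// cnorm_distC.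
  by rewrite ler_pM2l.
have h4 : cnorm (2%:R *: (k - m) + g * ((m - k) * m + k * (m - k))) <=
    (2 * cnorm k + 3) * d.
  by apply: le_trans (cnormD _ _) _; lra.
rewrite /M mulrAC; apply: ler_pM => //; try exact: cnorm_ge0.
lra.
Qed.

(** The same for an arbitrary element, from its real and imaginary parts scaled
    into the open unit ball; the bound 4 |b| on the lift does not depend on the
    quality of the approximation, and 1/8 makes the total error |b| / 2. *)
Lemma approx_lift (b : B) :
  exists a, cnorm a <= 4 * cnorm b /\ cnorm (b - phi a) <= cnorm b / 2.
Proof.
have [b0|b0] := eqVneq (cnorm b) 0.
  by exists 0; rewrite raddf0 subr0 b0 cnorm0 mulr0 mul0r.
have {}b0 : 0 < cnorm b by rewrite lt_neqAle eq_sym b0 cnorm_ge0.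
pose c : R[i] := ((4 * cnorm b)^-1)%:C%C.
have nc (x : B) : cnorm x <= 2 * cnorm b -> cnorm (c *: x) < 1.
  rewrite cnormZr ger0_norm ?invr_ge0 ?mulr_ge0 ?cnorm_ge0// => xb.
  by rewrite mulrC ltr_pdivrMr ?mulr_gt0//; lra.
have cJ : c^* = c := conjC_realC _.
have sb : cnorm (star b) = cnorm b := cnorm_starE b.
have e8 : 0 < (8^-1 : R) by rewrite invr_gt0.
have [||x [x1 xb]] := @approx_lift_selfadj (c *: (b + star b)) 8^-1 _ _ e8.
- by rewrite starZ cJ starD starK addrC.
- by apply: nc; have := cnormD b (star b); lra.
have [||y [y1 yb]] := @approx_lift_selfadj (c *: ('i%C *: (star b - b))) 8^-1 _ _ e8.
- by rewrite !starZ cJ starB starK conjC_i scaleNr -scalerN opprB.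
- by apply: nc; rewrite cnormZi; have := cnormB (star b) b; lra.
have bE : b = (2 * cnorm b)%:C%C *:
    (c *: (b + star b) + 'i%C *: (c *: ('i%C *: (star b - b)))).
  have -> : 'i%C *: (c *: ('i%C *: (star b - b))) = c *: (b - star b).
    by rewrite !scalerA mulrAC -expr2 sqr_i mulN1r scaleNr -scalerN opprB.
  have bc : (2 * cnorm b)%:C%C * c = (2^-1)%:C%C.
    by rewrite -rmorphM; congr _%:C%C; field; apply: lt0r_neq0.
  by rewrite -scalerDr addrACA subrr addr0 scalerA bc scale_half.
exists ((2 * cnorm b)%:C%C *: (x + 'i%C *: y)); split.
  rewrite cnormZr ger0_norm ?mulr_ge0 ?cnorm_ge0//.
  have := cnormD x ('i%C *: y); rewrite cnormZi => H.
  have : 2 * cnorm b * cnorm (x + 'i%C *: y) <= 2 * cnorm b * 2.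
    by rewrite ler_pM2l ?mulr_gt0//; lra.
  lra.
have -> k : phi (k *: (x + 'i%C *: y)) = k *: (phi x + 'i%C *: phi y).
  by rewrite linearZ linearD linearZ.
rewrite {1}bE -scalerBr opprD addrACA -scalerBr.
rewrite cnormZr ger0_norm ?mulr_ge0 ?cnorm_ge0//.
set u := c *: (b + star b) - _ in xb *; set v := _ - phi y in yb *.
have := cnormD u ('i%C *: v); rewrite cnormZi => H.
have : 2 * cnorm b * cnorm (u + 'i%C *: v) <= 2 * cnorm b * 4^-1.
  by rewrite ler_pM2l ?mulr_gt0//; lra.
lra.
Qed.

(** Successive approximation: the errors halve at each step, the corrections sum
    to a preimage. *)
Lemma dense_range_surj (b : B) : exists a, phi a = b.
Proof.
have [F FP] := choice approx_lift.
pose r n := iter n (fun c => c - phi (F c)) b.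
have rb n : cnorm (r n) <= 2^-1 ^+ n * cnorm b.
  elim: n => [|n IH]; first by rewrite expr0 mul1r.
  have [_] := FP (r n); rewrite exprS -[_ - _]/(r n.+1) => H; lra.
pose s n : U := \sum_(i < n) F (r i).
have sr n : phi (s n) = b - r n.
  elim: n => [|n IH]; first by rewrite /s big_ord0 raddf0 subrr.
  have -> : s n.+1 = s n + F (r n) by rewrite /s big_ord_recr.
  by rewrite rmorphD /= IH opprB addrAC -addrA.
have sd n k : cnorm (s (n + k)%N - s n) <= 8 * cnorm b * (2^-1 ^+ n - 2^-1 ^+ (n + k)).
  elim: k => [|k IH]; first by rewrite addn0 !subrr cnorm0 mulr0.
  have [H _] := FP (r (n + k)%N); have H2 := rb (n + k)%N.
  rewrite addnS /s big_ord_recr /= -/(s (n + k)%N) addrAC.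
  have := cnormD (s (n + k)%N - s n) (F (r (n + k)%N)).
  by rewrite exprS; lra.
have h0 : 0 <= (2^-1 : R) by rewrite invr_ge0.
have h1 : (2^-1 : R) < 1 by rewrite invf_lt1// ltr1n.
have b0 := cnorm_ge0 b.
have [|l lP] := @cnorm_complete R U s.
  move=> e e0; have [|N NP] := expr_lt_eps h0 h1 (e := e / (16 * (cnorm b + 1))).
    by rewrite divr_gt0//; lra.
  have He : 2^-1 ^+ N * (16 * (cnorm b + 1)) < e.
    by rewrite -ltr_pdivlMr ?NP//; lra.
  exists N => m n /subnKC <- /subnKC <-.
  apply: le_lt_trans (cnorm_split (s N) _ _) _; rewrite (cnorm_distC (s N)).
  have := sd N (m - N)%N; have := sd N (n - N)%N.
  have p0 := exprn_ge0 N h0.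
  have := exprn_ge0 (N + (m - N)) h0; have := exprn_ge0 (N + (n - N)) h0.
  nra.
exists l; apply/eqP; rewrite -subr_eq0; apply/eqP/cnorm_le_eps => e e0.
have [|N NP] := lP (e / 2); first lra.
have [|M MP] := expr_lt_eps h0 h1 (e := e / (2 * (cnorm b + 1))).
  by rewrite divr_gt0//; lra.
pose n := maxn N M.
have H1 := NP n (leq_maxl _ _); have H2 := MP n (leq_maxr _ _).
have {}H2 : 2^-1 ^+ n * (2 * (cnorm b + 1)) < e by rewrite -ltr_pdivlMr//; lra.
have := cnorm_split (phi (s n)) (phi l) b; rewrite -rmorphB.
have := star_morph_le (l - s n); rewrite [cnorm (l - _)]cnorm_distC.
have -> : phi (s n) - b = - r n by rewrite sr addrAC subrr sub0r.
rewrite cnormN; have := rb n; have := exprn_ge0 n h0; nra.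
Qed.

End StarMorphism.

(** * Completion of a star-algebra for a C*-seminorm *)

Section Completion.
Local Open Scope quotient_scope.
Variables (R : realType) (A : starAlgType R) (p : cstar_seminorm A).
Implicit Types (a b : A) (e : R).

Definition cauchy_for (u : nat -> A) : Prop := forall e, 0 < e ->
  exists N : nat, forall m n, (N <= m)%N -> (N <= n)%N -> p (u m - u n) < e.

Record cauchy_seq := CauchySeq {
  cauchy_fun :> nat -> A;
  cauchy_funP : cauchy_for cauchy_fun }.
Implicit Types u v w : cauchy_seq.

HB.instance Definition _ := gen_eqMixin cauchy_seq.
HB.instance Definition _ := gen_choiceMixin cauchy_seq.

Lemma cauchy_pair_lt u v (d : R) : 0 < d -> exists N : nat, forall m n,
  (N <= m)%N -> (N <= n)%N -> p (u m - u n) < d /\ p (v m - v n) < d.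
Proof.
move=> d0; have [N NP] := cauchy_funP u d0; have [M MP] := cauchy_funP v d0.
by exists (maxn N M) => m n; rewrite !geq_max => /andP[? ?] /andP[? ?]; split;
  [apply: NP|apply: MP].
Qed.

Lemma cauchy_bounded u : exists M : R, 0 < M /\
  exists N : nat, forall n, (N <= n)%N -> p (u n) <= M.
Proof.
have [N NP] := cauchy_funP u ltr01.
exists (p (u N) + 1); split; first by rewrite ltr_wpDl// seminorm_ge0.
exists N => n Nn; have := NP n N Nn (leqnn _).
by have := seminormD p (u n - u N) (u N); rewrite subrK; lra.
Qed.

Lemma cauchy_constP a : cauchy_for (fun=> a).
Proof. by move=> e e0; exists 0 => m n _ _; rewrite subrr seminorm0. Qed.

Lemma cauchy_addP u v : cauchy_for (fun n => u n + v n).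
Proof.
move=> e e0; have [|N NP] := @cauchy_pair_lt u v (e / 2); first lra.
exists N => m n /NP H /H[H1 H2]; rewrite opprD addrACA.
by have := seminormD p (u m - u n) (v m - v n); lra.
Qed.

Lemma cauchy_scaleP (k : R[i]) u : cauchy_for (fun n => k *: u n).
Proof.
move=> e e0; have k0 : 0 <= complex.Re `|k| by rewrite -ler0c norm_real.
have [|N NP] := @cauchy_funP u (e / (complex.Re `|k| + 1)).
  by rewrite divr_gt0// ltr_wpDl.
exists N => m n /NP H /H; rewrite -scalerBr seminormZ ltr_pdivlMr ?ltr_wpDl//.
by have := seminorm_ge0 p (u m - u n); lra.
Qed.

Lemma cauchy_oppP u : cauchy_for (fun n => - u n).
Proof.
move=> e /(cauchy_funP u)[N NP]; exists N => m n /NP H /H.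
by rewrite -opprD seminormN.
Qed.

Lemma cauchy_starP u : cauchy_for (fun n => star (u n)).
Proof.
move=> e /(cauchy_funP u)[N NP]; exists N => m n /NP H /H.
by rewrite -starB seminorm_starE.
Qed.

Lemma cauchy_mulP u v : cauchy_for (fun n => u n * v n).
Proof.
move=> e e0; have [Mu [Mu0 [Nu NuP]]] := cauchy_bounded u.
have [Mv [Mv0 [Nv NvP]]] := cauchy_bounded v.
have [|N NP] := @cauchy_pair_lt u v (e / (Mu + Mv)).
  by rewrite divr_gt0// addr_gt0.
exists (maxn N (maxn Nu Nv)) => m n.
rewrite !geq_max => /and3P[Nm Num Nvm] /and3P[Nn Nun Nvn].
have [H1 H2] := NP m n Nm Nn; have H3 := NuP n Nun; have H4 := NvP m Nvm.
have -> : u m * v m - u n * v n = (u m - u n) * v m + u n * (v m - v n).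
  by rewrite mulrBl mulrBr addrA subrK.
apply: le_lt_trans (seminormD _ _ _) _.
have := seminormM p (u m - u n) (v m); have := seminormM p (u n) (v m - v n).
have d1 := seminorm_ge0 p (u m - u n); have d2 := seminorm_ge0 p (v m - v n).
have d3 := seminorm_ge0 p (u n); have d4 := seminorm_ge0 p (v m).
move: H1 H2; rewrite !ltr_pdivlMr ?addr_gt0// => H1 H2.
set x := p (u m - u n) in H1 d1 *; set y := p (v m - v n) in H2 d2 *.
move=> K1 K2.
have E1 : p (u n) * y <= Mu * y by apply: ler_wpM2r.
have E2 : x * p (v m) <= x * Mv by apply: ler_wpM2l.
rewrite -(ltr_pM2r (addr_gt0 Mu0 Mv0)).
have : (Mu * y + x * Mv) * (Mu + Mv) < e * (Mu + Mv).
  rewrite mulrDl -mulrA [x * Mv * _]mulrAC.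
  have : Mu * (y * (Mu + Mv)) < Mu * e by rewrite ltr_pM2l.
  have : x * (Mu + Mv) * Mv < e * Mv by rewrite ltr_pM2r.
  lra.
apply: le_lt_trans; apply: ler_wpM2r; last lra.
by rewrite addr_ge0// ltW.
Qed.

Definition cauchy_const a := CauchySeq (cauchy_constP a).
Definition cauchy_add u v := CauchySeq (cauchy_addP u v).
Definition cauchy_opp u := CauchySeq (cauchy_oppP u).
Definition cauchy_scale k u := CauchySeq (cauchy_scaleP k u).
Definition cauchy_mul u v := CauchySeq (cauchy_mulP u v).
Definition cauchy_star u := CauchySeq (cauchy_starP u).

Definition null_seq (u : nat -> A) : Prop := forall e, 0 < e ->
  exists N : nat, forall n, (N <= n)%N -> p (u n) < e.

Lemma null_le (M : R) (x y : nat -> A) : 0 < M -> null_seq x ->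
  (exists N : nat, forall n, (N <= n)%N -> p (y n) <= M * p (x n)) -> null_seq y.
Proof.
move=> M0 x0 [N NP] e e0; have [|L LP] := x0 (e / M); first exact: divr_gt0.
exists (maxn N L) => n; rewrite geq_max => /andP[Nn Ln].
by apply: le_lt_trans (NP n Nn) _; rewrite mulrC -ltr_pdivlMr// LP.
Qed.

Lemma null_add (x y : nat -> A) : null_seq x -> null_seq y ->
  null_seq (fun n => x n + y n).
Proof.
move=> x0 y0 e e0; have [|N NP] := x0 (e / 2); first lra.
have [|L LP] := y0 (e / 2); first lra.
exists (maxn N L) => n; rewrite geq_max => /andP[/NP Nn /LP Ln].
by have := seminormD p (x n) (y n); lra.
Qed.

Definition cauchy_eq : rel cauchy_seq := fun u v => `[< null_seq (fun n => u n - v n) >].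

Lemma cauchy_eq_refl : reflexive cauchy_eq.
Proof.
by move=> u; apply/asboolP => e e0; exists 0 => n _; rewrite subrr seminorm0.
Qed.

Lemma cauchy_eq_sym : symmetric cauchy_eq.
Proof.
have s u v : cauchy_eq u v -> cauchy_eq v u.
  move=> /asboolP uv; apply/asboolP => e /uv[N NP]; exists N => n /NP.
  by rewrite seminorm_distC.
by move=> u v; apply/idP/idP; apply: s.
Qed.

Lemma cauchy_eq_trans : transitive cauchy_eq.
Proof.
move=> v u w /asboolP uv /asboolP vw; apply/asboolP.
suff -> : (fun n => u n - w n) = (fun n => (u n - v n) + (v n - w n)) by exact: null_add.
by apply/funext => n; rewrite addrA subrK.
Qed.

Canonical cauchy_equiv := EquivRel cauchy_eq cauchy_eq_refl cauchy_eq_sym cauchy_eq_trans.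

Definition completion := {eq_quot cauchy_equiv}.
HB.instance Definition _ := Choice.on completion.

Definition cclass u : completion := \pi_{eq_quot cauchy_equiv} u.
Definition crepr (x : completion) : cauchy_seq := repr x.

Lemma creprK x : cclass (crepr x) = x.
Proof. exact: reprK. Qed.

Lemma cclassP u v : cclass u = cclass v <-> null_seq (fun n => u n - v n).
Proof. by split=> [/eqmodP/asboolP//|uv]; apply/eqmodP/asboolP. Qed.

Lemma cclass_ext u v : u =1 v -> cclass u = cclass v.
Proof. by move=> uv; apply/cclassP => e e0; exists 0 => n _; rewrite uv subrr seminorm0. Qed.

Lemma crepr_class u : null_seq (fun n => crepr (cclass u) n - u n).
Proof. by apply/cclassP; rewrite creprK. Qed.

Lemma cclassW (P : completion -> Prop) : (forall u, P (cclass u)) -> forall x, P x.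
Proof. by move=> Pu x; rewrite -[x]creprK. Qed.

Definition qadd x y := cclass (cauchy_add (crepr x) (crepr y)).
Definition qopp x := cclass (cauchy_opp (crepr x)).
Definition qmul x y := cclass (cauchy_mul (crepr x) (crepr y)).
Definition qscale k x := cclass (cauchy_scale k (crepr x)).
Definition qstar x := cclass (cauchy_star (crepr x)).

Lemma qaddE u v : qadd (cclass u) (cclass v) = cclass (cauchy_add u v).
Proof.
apply/cclassP; rewrite (_ : (fun n => _) = fun n =>
  (crepr (cclass u) n - u n) + (crepr (cclass v) n - v n)).
  by apply: null_add; apply: crepr_class.
by apply/funext => n; rewrite /= opprD addrACA.
Qed.

Lemma qoppE u : qopp (cclass u) = cclass (cauchy_opp u).
Proof.
apply/cclassP; apply: null_le ltr01 (crepr_class u) _; exists 0 => n _.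
by rewrite /= -opprD seminormN mul1r.
Qed.

Lemma qstarE u : qstar (cclass u) = cclass (cauchy_star u).
Proof.
apply/cclassP; apply: null_le ltr01 (crepr_class u) _; exists 0 => n _.
by rewrite /= -starB seminorm_starE mul1r.
Qed.

Lemma qscaleE k u : qscale k (cclass u) = cclass (cauchy_scale k u).
Proof.
have k0 : 0 <= complex.Re `|k| by rewrite -ler0c norm_real.
apply/cclassP; apply: (null_le (M := complex.Re `|k| + 1)) (crepr_class u) _.
  by rewrite ltr_wpDl.
exists 0 => n _; rewrite /= -scalerBr seminormZ.
by apply: ler_wpM2r; rewrite ?seminorm_ge0// lerDl.
Qed.

(** Independence of representatives, for which Cauchy sequences must be bounded. *)
Lemma qmulE u v : qmul (cclass u) (cclass v) = cclass (cauchy_mul u v).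
Proof.
apply/cclassP; set u' := crepr (cclass u); set v' := crepr (cclass v).
rewrite (_ : (fun n => _) = fun n => (u' n - u n) * v' n + u n * (v' n - v n)); last first.
  by apply/funext => n; rewrite mulrBl mulrBr addrA subrK.
have [Mu [Mu0 [Nu NuP]]] := cauchy_bounded u.
have [Mv [Mv0 [Nv NvP]]] := cauchy_bounded v'.
apply: null_add.
  apply: (null_le Mv0) (crepr_class u) _; exists Nv => n /NvP H.
  apply: le_trans (seminormM _ _ _) _; rewrite mulrC.
  by apply: ler_wpM2r => //; apply: seminorm_ge0.
apply: (null_le Mu0) (crepr_class v) _; exists Nu => n /NuP H.
apply: le_trans (seminormM _ _ _) _.
by apply: ler_wpM2r => //; apply: seminorm_ge0.
Qed.

Definition cembed a : completion := cclass (cauchy_const a).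

Fact qaddA : associative qadd.
Proof.
elim/cclassW => u; elim/cclassW => v; elim/cclassW => w; rewrite !qaddE.
by apply: cclass_ext => n /=; rewrite addrA.
Qed.

Fact qaddC : commutative qadd.
Proof.
elim/cclassW => u; elim/cclassW => v; rewrite !qaddE.
by apply: cclass_ext => n /=; rewrite addrC.
Qed.

Fact qadd0 : left_id (cembed 0) qadd.
Proof. by elim/cclassW => u; rewrite qaddE; apply: cclass_ext => n /=; rewrite add0r. Qed.

Fact qaddN : left_inverse (cembed 0) qopp qadd.
Proof.
by elim/cclassW => u; rewrite qoppE qaddE; apply: cclass_ext => n /=; rewrite addNr.
Qed.

HB.instance Definition _ := GRing.isZmodule.Build completion qaddA qaddC qadd0 qaddN.

Lemma cclassD u v : cclass u + cclass v = cclass (cauchy_add u v).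
Proof. exact: qaddE. Qed.

Lemma cclassN u : - cclass u = cclass (cauchy_opp u).
Proof. exact: qoppE. Qed.

Fact qmulA : associative qmul.
Proof.
elim/cclassW => u; elim/cclassW => v; elim/cclassW => w; rewrite !qmulE.
by apply: cclass_ext => n /=; rewrite mulrA.
Qed.

Fact qmul1l : left_id (cembed 1) qmul.
Proof. by elim/cclassW => u; rewrite qmulE; apply: cclass_ext => n /=; rewrite mul1r. Qed.

Fact qmul1r : right_id (cembed 1) qmul.
Proof. by elim/cclassW => u; rewrite qmulE; apply: cclass_ext => n /=; rewrite mulr1. Qed.

Fact qmulDl : left_distributive qmul +%R.
Proof.
elim/cclassW => u; elim/cclassW => v; elim/cclassW => w; rewrite cclassD !qmulE cclassD.
by apply: cclass_ext => n /=; rewrite mulrDl.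
Qed.

Fact qmulDr : right_distributive qmul +%R.
Proof.
elim/cclassW => u; elim/cclassW => v; elim/cclassW => w; rewrite cclassD !qmulE cclassD.
by apply: cclass_ext => n /=; rewrite mulrDr.
Qed.

Fact qone_neq0 : cembed 1 != 0.
Proof.
apply/eqP => /cclassP/(_ _ ltr01)[N /(_ N (leqnn N))].
by rewrite /= subr0 seminorm1 ltxx.
Qed.

HB.instance Definition _ := GRing.Zmodule_isNzRing.Build completion qmulA
  qmul1l qmul1r qmulDl qmulDr qone_neq0.

Lemma cclassM u v : cclass u * cclass v = cclass (cauchy_mul u v).
Proof. exact: qmulE. Qed.

Fact qscaleA k l x : qscale k (qscale l x) = qscale (k * l) x.
Proof.
by elim/cclassW: x => u; rewrite !qscaleE; apply: cclass_ext => n /=; rewrite scalerA.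
Qed.

Fact qscale1 : left_id 1 qscale.
Proof. by elim/cclassW => u; rewrite qscaleE; apply: cclass_ext => n /=; rewrite scale1r. Qed.

Fact qscaleDr : right_distributive qscale +%R.
Proof.
move=> k; elim/cclassW => u; elim/cclassW => v; rewrite cclassD !qscaleE cclassD.
by apply: cclass_ext => n /=; rewrite scalerDr.
Qed.

Fact qscaleDl x : {morph qscale^~ x : k l / k + l}.
Proof.
elim/cclassW: x => u k l; rewrite !qscaleE cclassD.
by apply: cclass_ext => n /=; rewrite scalerDl.
Qed.

HB.instance Definition _ := GRing.Zmodule_isLmodule.Build R[i] completion
  qscaleA qscale1 qscaleDr qscaleDl.

Lemma cclassZ k u : k *: cclass u = cclass (cauchy_scale k u).
Proof. exact: qscaleE. Qed.

Fact qscaleAl (k : R[i]) (x y : completion) : k *: (x * y) = (k *: x) * y.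
Proof.
elim/cclassW: x => u; elim/cclassW: y => v; rewrite cclassM !cclassZ cclassM.
by apply: cclass_ext => n /=; rewrite scalerAl.
Qed.

Fact qscaleAr (k : R[i]) (x y : completion) : k *: (x * y) = x * (k *: y).
Proof.
elim/cclassW: x => u; elim/cclassW: y => v; rewrite cclassM !cclassZ cclassM.
by apply: cclass_ext => n /=; rewrite scalerAr.
Qed.

HB.instance Definition _ := GRing.Lmodule_isLalgebra.Build R[i] completion qscaleAl.
HB.instance Definition _ := GRing.Lalgebra_isAlgebra.Build R[i] completion qscaleAr.

Fact qstarD : {morph qstar : x y / x + y}.
Proof.
elim/cclassW => u; elim/cclassW => v; rewrite (cclassD u v) !qstarE cclassD.
by apply: cclass_ext => n /=; rewrite starD.
Qed.

Fact qstarZ (k : R[i]) (x : completion) : qstar (k *: x) = k^* *: qstar x.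
Proof.
elim/cclassW: x => u; rewrite (cclassZ k u) !qstarE cclassZ.
by apply: cclass_ext => n /=; rewrite starZ.
Qed.

Fact qstarM (x y : completion) : qstar (x * y) = qstar y * qstar x.
Proof.
elim/cclassW: x => u; elim/cclassW: y => v; rewrite (cclassM u v) !qstarE cclassM.
by apply: cclass_ext => n /=; rewrite starM.
Qed.

Fact qstarK : involutive qstar.
Proof. by elim/cclassW => u; rewrite !qstarE; apply: cclass_ext => n /=; rewrite starK. Qed.

HB.instance Definition _ := isStarAlgebra.Build R completion qstarD qstarZ qstarM qstarK.

Lemma cclass_star u : star (cclass u) = cclass (cauchy_star u).
Proof. exact: qstarE. Qed.

End Completion.

Section CompletionNorm.
Variables (R : realType) (A : starAlgType R) (p : cstar_seminorm A).
Local Notation Q := (completion p).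
Local Notation cauchy_seq := (@cauchy_seq R A p).
Implicit Types (a b : A) (e : R) (u v : cauchy_seq) (x y : Q).

Lemma seminorm_dist a b : `|p a - p b| <= p (a - b).
Proof.
have := seminormD p (a - b) b; have := seminormD p (b - a) a.
rewrite !subrK (seminorm_distC p b a) ler_norml; lra.
Qed.

Lemma cauchy_norm_is_cvg u : cvg (p (u n) @[n --> \oo]).
Proof.
apply/cauchy_cvgP/cauchy_exP => e e0; have [N NP] := cauchy_funP u e0.
exists (p (u N)); exists N => // n Nn; rewrite /ball /=.
exact: le_lt_trans (seminorm_dist _ _) (NP _ _ (leqnn _) Nn).
Qed.

Definition qnorm x : R := lim (p (crepr x n) @[n --> \oo]).

Lemma qnorm_cvg u : p (u n) @[n --> \oo] --> qnorm (cclass u).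
Proof.
apply/cvgrPdist_lt => e e0.
have /cvgrPdist_lt/(_ (e / 2)) : p (crepr (cclass u) n) @[n --> \oo] --> qnorm (cclass u).
  exact: cauchy_norm_is_cvg.
have e2 : 0 < e / 2 by lra.
move=> /(_ e2)[N _ NP]; have [M MP] := crepr_class u e2.
exists (maxn N M) => // n; rewrite /= geq_max => /andP[Nn Mn].
have := NP n Nn; have := MP n Mn; rewrite /= => H1 H2.
rewrite -[_ - _](subrKA (p (crepr (cclass u) n))).
apply: le_lt_trans (ler_normD _ _) _.
have := seminorm_dist (crepr (cclass u) n) (u n); lra.
Qed.

Arguments qnorm_cvg : clear implicits.

Lemma qnorm_unique u (l : R) : p (u n) @[n --> \oo] --> l -> qnorm (cclass u) = l.
Proof. by move=> ul; rewrite -(cvg_lim _ ul)// (cvg_lim _ (qnorm_cvg u)). Qed.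

Lemma qnorm_embed a : qnorm (cembed p a) = p a.
Proof. apply: (@qnorm_unique (cauchy_const p a)); rewrite /=; apply: cvg_cst. Qed.

Fact qnormD x y : qnorm (x + y) <= qnorm x + qnorm y.
Proof.
elim/cclassW: x => u; elim/cclassW: y => v; rewrite cclassD.
apply: ler_cvg_to (qnorm_cvg _) (cvgD (qnorm_cvg u) (qnorm_cvg v)) _.
by apply: nearW => n; apply: seminormD.
Qed.

Fact qnormM x y : qnorm (x * y) <= qnorm x * qnorm y.
Proof.
elim/cclassW: x => u; elim/cclassW: y => v; rewrite cclassM.
apply: ler_cvg_to (qnorm_cvg _) (cvgM (qnorm_cvg u) (qnorm_cvg v)) _.
by apply: nearW => n; apply: seminormM.
Qed.

Fact qnormZ (k : R[i]) x : qnorm (k *: x) = complex.Re `|k| * qnorm x.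
Proof.
elim/cclassW: x => u; rewrite cclassZ; apply: qnorm_unique.
under eq_cvg do rewrite /= seminormZ.
by apply: cvgMr (qnorm_cvg u).
Qed.

Fact qnorm_star x : qnorm (star x * x) = qnorm x ^+ 2.
Proof.
elim/cclassW: x => u; rewrite cclass_star cclassM; apply: qnorm_unique.
under eq_cvg do rewrite /= seminorm_star.
by apply: cvgM; apply: qnorm_cvg.
Qed.

Fact qnorm_eq0 x : qnorm x = 0 -> x = 0.
Proof.
elim/cclassW: x => u u0; apply/cclassP => e e0.
have /cvgrPdist_lt/(_ e e0)[N _ NP] := qnorm_cvg u.
exists N => n /NP /=; rewrite u0 sub0r normrN subr0 ger0_norm//.
exact: seminorm_ge0.
Qed.

Lemma cembedB a b : cembed p (a - b) = cembed p a - cembed p b.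
Proof. by rewrite /cembed cclassN cclassD; apply: cclass_ext. Qed.

Lemma qnorm_sub_embed u e : 0 < e -> exists N : nat, forall n, (N <= n)%N ->
  qnorm (cclass u - cembed p (u n)) <= e.
Proof.
move=> e0; have [N NP] := cauchy_funP u e0; exists N => n Nn.
rewrite /cembed cclassN cclassD.
refine (cvgr_to_le (qnorm_cvg _) _).
by exists N => // m Nm; apply/ltW/NP.
Qed.

Lemma qnorm_split y x z : qnorm (x - z) <= qnorm (x - y) + qnorm (y - z).
Proof. by rewrite -[x - z](subrKA y); apply: qnormD. Qed.

Lemma qnorm_distC x y : qnorm (x - y) = qnorm (y - x).
Proof.
rewrite -opprB -scaleN1r qnormZ normrN1.
by rewrite -[complex.Re 1]/(1 : R) mul1r.
Qed.

Lemma cembed_dense x e : 0 < e -> exists a, qnorm (x - cembed p a) < e.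
Proof.
elim/cclassW: x => u e0; have [|N NP] := @qnorm_sub_embed u (e / 2); first lra.
by exists (u N); have := NP N (leqnn _); lra.
Qed.

(** A Cauchy sequence of the completion is at distance tending to 0 from a
    sequence of A, whose class is the limit. *)
Fact qnorm_complete (s : nat -> Q) :
  (forall e, 0 < e -> exists N : nat, forall m n : nat,
      (N <= m)%N -> (N <= n)%N -> qnorm (s m - s n) < e) ->
  exists l, forall e, 0 < e -> exists N : nat, forall n : nat,
      (N <= n)%N -> qnorm (s n - l) < e.
Proof.
move=> sC.
have /choice[t tP] : forall n, exists a, qnorm (s n - cembed p a) < n.+1%:R^-1.
  by move=> n; apply: cembed_dense; rewrite invr_gt0.
have tlim e : 0 < e -> exists N : nat, forall n, (N <= n)%N ->
    qnorm (s n - cembed p (t n)) < e.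
  move=> e0; have [N _ NP] : \forall n \near \oo, n.+1%:R^-1 < e.
    exact: near_infty_natSinv_lt (PosNum e0).
  by exists N => n /NP; apply: lt_trans (tP n).
have tC : cauchy_for p t.
  move=> e e0; have e3 : 0 < e / 3 by lra.
  have [N NP] := tlim _ e3; have [M MP] := sC _ e3.
  exists (maxn N M) => m n; rewrite !geq_max => /andP[Nm Mm] /andP[Nn Mn].
  rewrite -qnorm_embed cembedB.
  have := qnorm_split (s m) (cembed p (t m)) (cembed p (t n)).
  have := qnorm_split (s n) (s m) (cembed p (t n)).
  have := NP m Nm; have := NP n Nn; have := MP m n Mm Mn.
  rewrite (qnorm_distC (cembed p (t m)) (s m)); lra.
exists (cclass (CauchySeq tC)) => e e0; have e2 : 0 < e / 2 by lra.
have [N NP] := tlim _ e2; have [M MP] := qnorm_sub_embed (CauchySeq tC) e2.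
exists (maxn N M) => n; rewrite geq_max => /andP[/NP Nn /MP Mn].
have := qnorm_split (cembed p (t n)) (s n) (cclass (CauchySeq tC)).
move: Mn; rewrite (qnorm_distC _ (cembed p _)) /=; lra.
Qed.

HB.instance Definition _ := isCStarAlgebra.Build R Q
  qnormD qnormZ qnorm_eq0 qnormM qnorm_star qnorm_complete.

Fact cembed_linear : linear (cembed p).
Proof. by move=> k a b; rewrite /cembed cclassZ cclassD; apply: cclass_ext. Qed.

Fact cembed_monoid : monoid_morphism (cembed p).
Proof. by split=> // a b; rewrite /cembed cclassM; apply: cclass_ext. Qed.

HB.instance Definition _ := GRing.isLinear.Build R[i] A Q _ (cembed p) cembed_linear.
HB.instance Definition _ := GRing.isMonoidMorphism.Build A Q (cembed p) cembed_monoid.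

Lemma cstar_completion : exists (B : cstarAlgType R) (iota : {lrmorphism A -> B}),
  [/\ star_preserving iota, forall a, cnorm (iota a) = p a
    & cclosure (range iota) = setT].
Proof.
exists (Q : cstarAlgType R), (cembed p : {lrmorphism A -> Q}); split.
- by move=> a; rewrite /cembed /= cclass_star; apply: cclass_ext.
- exact: qnorm_embed.
apply/seteqP; split=> // x _ e e0; have [a xa] := cembed_dense x e0.
by exists (cembed p a) => //; exists a.
Qed.

End CompletionNorm.

(** * Double cosets and the degree *)

Section Degree.
Variables (R : realType) (G : groupType) (G0 : groupClosed G).
Hypothesis hp : hecke_pair G0.
Local Notation C := R[i].
Local Notation RC := (right_cosets G0).
Local Notation DC := (double_coset G0).
Local Notation hpred := (@hecke_pred R G G0).
Implicit Types (f g : G -> C) (x y z : G).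

Definition hecke_deg f : C := \sum_(X \in RC) f (coset_repr X).

Lemma hecke_deg_linear (k : C) f g : f \in hpred -> g \in hpred ->
  hecke_deg (fun x => k * f x + g x) = k * hecke_deg f + hecke_deg g.
Proof.
move=> fH gH; rewrite /hecke_deg.
pose supp f := [set X | RC X /\ f (coset_repr X) != 0].
have S f' : supp f' `<=` RC by move=> X [].
have fS f' X : ~ supp f' X -> RC X -> f' (coset_repr X) = 0.
  by move=> n XR; apply/eqP/negPn/negP => fX; apply: n; split.
have SU : supp f `|` supp g `<=` RC by rewrite subUset; split; apply: S.
have fin : finite_set (supp f `|` supp g).
  by rewrite finite_setU; split; apply: hecke_finr.
rewrite -!(fsbig_widen (supp f `|` supp g) RC)//; first 1 last.
- by move=> X [XR /not_orP[nf ng]]; rewrite /= (fS g).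
- by move=> X [XR /not_orP[nf ng]]; rewrite /= (fS f).
- by move=> X [XR /not_orP[nf ng]]; rewrite /= (fS f)// (fS g)// mulr0 addr0.
by rewrite fsbig_split// mulr_fsumr.
Qed.

(** The sum over right cosets is invariant under right translation, which is what
    makes the degree multiplicative. *)
Lemma hecke_deg_conv f g : f \in hpred -> g \in hpred ->
  hecke_deg (hecke_conv G0 f g) = hecke_deg f * hecke_deg g.
Proof.
move=> fH gH; rewrite /hecke_deg.
pose S := [set Y | RC Y /\ g (coset_repr Y) != 0].
have Sfin : finite_set S by apply: hecke_finr.
pose T Y := [set X | RC X /\ f (coset_repr X * (coset_repr Y)^-1)%g != 0].
have Tfin Y : finite_set (T Y).
  have [s sP] := hecke_suppr fH hp.
  apply: (sub_finite_set (B := (fun z => right_coset G0 (z * coset_repr Y)%g) @` [set` s])).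
    move=> X [XR /sP[z zs [h hG e]]]; exists z => //.
    rewrite -[RHS](right_coset_repr XR); apply/esym/right_coset_eq.
    by exists h => //; rewrite mulgA -e mulgVK.
  exact: finite_image.
have TSfin : finite_set (\bigcup_(Y in S) T Y) by apply: bigcup_finite.
have TSR : \bigcup_(Y in S) T Y `<=` RC by move=> X [Y _ []].
rewrite -(fsbig_widen (\bigcup_(Y in S) T Y) RC)//; last first.
  move=> X [XR nX]; rewrite /= /hecke_conv; apply: fsbig1 => Y YR.
  apply/eqP; rewrite mulf_eq0 -[_ || _]negbK negb_or; apply/negP => /andP[fX gY].
  by apply: nX; exists Y.
under eq_fsbigr do rewrite (hecke_convEr G0).
rewrite exchange_fsbig// -[X in _ * X](fsbig_widen S RC)//; last 2 first.
- by move=> X [].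
- by move=> Y [YR nY]; apply/eqP/negPn/negP => gY; apply: nY.
rewrite mulr_fsumr; apply: eq_fsbigr => Y /set_mem YS.
rewrite -mulr_fsuml; congr (_ * _).
rewrite (hecke_rsum_translate (coset_repr Y)^-1%g (hecke_invl fH)).
apply: fsbig_widen => // X [XR nX]; apply/eqP/negPn/negP => fX.
by apply: nX; exists Y.
Qed.

Lemma double_coset_refl x : DC x x.
Proof. by exists 1%g, 1%g; rewrite gpred1 mul1g mulg1. Qed.

Lemma double_coset_eq x y : DC x y -> DC y = DC x.
Proof.
case=> h [k [hG kG ->]]; apply/seteqP; split=> z.
  case=> a [b [aG bG ->]]; exists (a * h)%g, (k * b)%g.
  by split; rewrite ?gpredM// !mulgA.
case=> a [b [aG bG ->]]; exists (a * h^-1)%g, (k^-1 * b)%g.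
by split; rewrite ?gpredM ?gpredV// !mulgA mulgVK mulgK.
Qed.

Lemma double_coset_right x y : DC x y -> right_coset G0 y `<=` DC x.
Proof.
move=> /double_coset_eq <- _ [h hG ->].
by exists h, 1%g; rewrite gpred1 hG mulg1.
Qed.

Lemma double_coset_repr x X : RC X -> DC x (coset_repr X) <-> X `<=` DC x.
Proof.
move=> XR; split; first by move=> /double_coset_right; rewrite (right_coset_repr XR).
apply; rewrite -{1}(right_coset_repr XR).
by exists 1%g; rewrite ?gpred1 ?mul1g.
Qed.

Lemma Rnum_eq x y : DC x y -> Rnum G0 y = Rnum G0 x.
Proof. by move=> /double_coset_eq xy; rewrite /Rnum xy. Qed.

Lemma Lnum_eq x y : DC x y -> Lnum G0 y = Lnum G0 x.
Proof. by move=> /double_coset_eq xy; rewrite /Lnum xy. Qed.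

Lemma Rnum_gt0 x : (0 < Rnum G0 x)%N.
Proof.
rewrite /Rnum cardfs_gt0; apply/fset0Pn; exists (right_coset G0 x).
rewrite in_fset_set; last exact: finite_right_cosets.
rewrite inE; split; first by exists x.
exact/double_coset_right/double_coset_refl.
Qed.

Lemma Lnum_gt0 x : (0 < Lnum G0 x)%N.
Proof. by rewrite LnumE// Rnum_gt0. Qed.

Lemma hecke_charE x y : DC x y -> hecke_char R G0 x y = 1.
Proof. by move=> xy; rewrite /hecke_char mem_set. Qed.

Lemma hecke_char_neq0 x y : hecke_char R G0 x y != 0 -> DC x y.
Proof. by rewrite /hecke_char pnatr_eq0 eqb0 negbK inE. Qed.

(** The weight m allows for the twist by the modular function as well as for the
    degree itself, where m is 1. *)
Lemma hecke_deg_char x (m : G -> C) : (forall y, DC x y -> m y = m x) ->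
  hecke_deg (fun y => hecke_char R G0 x y * m y) = (Rnum G0 x)%:R * m x.
Proof.
move=> mx; rewrite /hecke_deg /Rnum; set D := [set X | _].
have Dfin : finite_set D by apply: finite_right_cosets.
rewrite -(fsbig_widen D RC); first last.
- move=> X [XR nX]; rewrite /= /hecke_char memNset ?mul0r// => /(double_coset_repr _ XR) H.
  by apply: nX.
- by move=> X [].
rewrite fsbig_finite// (eq_big_seq (fun=> m x)) => [|X].
  by rewrite big_const_seq count_predT iter_addr_0 mulr_natl.
rewrite in_fset_set// inE => -[XR /(double_coset_repr _ XR) xX].
by rewrite hecke_charE// mul1r mx.
Qed.

(** The right cosets in the double coset of s^-1 are those of the s^-1 h, and G0 s^-1
    is the only one of them when each s^-1 h s is in G0. *)
Lemma Lnum1P s : Lnum G0 s = 1%N <-> forall h, h \in G0 -> (s^-1 * h * s)%g \in G0.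
Proof.
rewrite LnumE// /Rnum; set D := [set X | _].
have Dfin : finite_set D by apply: finite_right_cosets.
have Ds : D (right_coset G0 s^-1).
  by split; [exists s^-1%g|exact/double_coset_right/double_coset_refl].
split=> [/eqP/cardfs1P[X XE] h hG|sG].
  have DX Y : D Y -> Y = X.
    by move=> DY; apply/eqP; rewrite -in_fset1 -XE in_fset_set// inE.
  have Dh : D (right_coset G0 (s^-1 * h)%g).
    split; first by exists (s^-1 * h)%g.
    apply: double_coset_right; exists 1%g, h; rewrite gpred1 mul1g; split=> //.
  have := DX _ Ds; rewrite -(DX _ Dh) => E.
  have : right_coset G0 s^-1 (s^-1 * h)%g.
    by rewrite E; exists 1%g; rewrite ?gpred1 ?mul1g.
  by move=> /right_cosetP; rewrite invgK.
have -> : D = [set right_coset G0 s^-1]; last by rewrite fset_set1 cardfs1.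
apply/seteqP; split=> [X [XR] /(double_coset_repr _ XR)|_ -> //].
move=> [h [k [hG kG E]]]; rewrite /= -[LHS](right_coset_repr XR) E.
apply: right_coset_eq; exists (h * (s^-1 * k * s))%g; first by rewrite gpredM ?sG.
by rewrite !mulgA mulgK.
Qed.

Lemma Lnum1M s t : Lnum G0 s = 1%N -> Lnum G0 t = 1%N -> Lnum G0 (s * t)%g = 1%N.
Proof.
move=> /Lnum1P sG /Lnum1P tG; apply/Lnum1P => h hG.
by have := tG _ (sG _ hG); rewrite invgM !mulgA.
Qed.

Lemma Lnum_inv x : Lnum G0 x^-1%g = Rnum G0 x.
Proof. by rewrite LnumE// invgK. Qed.

Lemma Rnum_inv x : Rnum G0 x^-1%g = Lnum G0 x.
Proof. by rewrite LnumE. Qed.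

End Degree.

(** * The normalized basis of the Hecke algebra *)

Section HeckeBasis.
Variables (R : realType) (G : groupType) (G0 : groupClosed G).
Variable hp : hecke_pair G0.
Local Notation C := R[i].
Local Notation RC := (right_cosets G0).
Local Notation DC := (double_coset G0).
Local Notation H := (hecke_alg R hp).
Local Notation cl := (hecke_class R hp).
Local Notation rnum x := ((Rnum G0 x)%:R : R).
Local Notation lnum x := ((Lnum G0 x)%:R : R).
Implicit Types (f g : H) (x y z s t : G).

Lemma hecke_ext f g : (forall x, f x = g x) -> f = g.
Proof. by move=> fg; apply: val_inj; apply/funext. Qed.

Lemma hecke_classE x y : DC x y -> cl y = cl x.
Proof.
move=> xy; apply: hecke_ext => z.
by rewrite /= /hecke_char (double_coset_eq xy).
Qed.

Lemma star_class x : star (cl x) = cl x^-1%g.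
Proof.
apply: hecke_ext => y; rewrite /= /hecke_star /hecke_char conjC_nat.
congr (_%:R); congr nat_of_bool; apply/idP/idP; rewrite !inE.
  by move=> /double_coset_inv; rewrite invgK.
by move=> /double_coset_inv; rewrite invgK.
Qed.

Lemma hecke_supported f y : (forall x, f x != 0 -> DC y x) -> f = f y *: cl y.
Proof.
move=> fy; apply: hecke_ext => x; rewrite -[RHS]/(f y * hecke_char R G0 y x).
have [yx|nyx] := pselect (DC y x).
  rewrite hecke_charE// mulr1; case: yx => h [k [hG kG ->]].
  by rewrite (hecke_invr (valP f))// (hecke_invl (valP f)).
have [->|/fy//] := eqVneq (f x) 0.
by rewrite /hecke_char memNset// mulr0.
Qed.

(** If L(s) = 1 the double coset of s is the left coset s G0, so that the product
    of the double cosets of y and s is the single double coset of y s. *)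
Lemma class_mulr y s : Lnum G0 s = 1%N ->
  exists2 c : R, 0 <= c & cl y * cl s = c%:C%C *: cl (y * s)%g.
Proof.
move=> /(Lnum1P hp) sG; set f := cl y * cl s.
have fE x : f x = hecke_conv G0 (hecke_char R G0 y) (hecke_char R G0 s) x by [].
have f0 : 0 <= f (y * s)%g.
  by rewrite fE; apply: fsumr_ge0 => X _; rewrite mulr_ge0// ler0n.
exists (complex.Re (f (y * s)%g)).
  by move: f0; rewrite lecE /= => /andP[].
rewrite (RRe_real (ger0_real f0)); apply: hecke_supported => x; rewrite fE => fx.
have [X XR] : exists2 X, RC X & hecke_char R G0 y (x * (coset_repr X)^-1)%g *
    hecke_char R G0 s (coset_repr X) != 0.
  apply: contra_neqP fx => /forall2NP nX; apply: fsbig1 => X XR.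
  by have [//|/negP/negPn/eqP] := nX X.
rewrite mulf_eq0 negb_or => /andP[/hecke_char_neq0[a [b [aG bG E]]]].
move=> /hecke_char_neq0[h [k [hG kG E']]].
exists a, ((s^-1 * (b * h) * s) * k)%g; split => //.
  by rewrite gpredM ?sG ?gpredM.
have -> : x = (x * (coset_repr X)^-1 * coset_repr X)%g by rewrite mulgVK.
by rewrite E E' !mulgA mulgK.
Qed.

Definition degR f : C := hecke_deg G0 f.
Definition degL f : C := degR (star f).

Lemma degRM f g : degR (f * g) = degR f * degR g.
Proof. exact: (hecke_deg_conv hp (valP f) (valP g)). Qed.

Lemma degLM f g : degL (f * g) = degL f * degL g.
Proof. by rewrite /degL starM degRM mulrC. Qed.

Lemma degRZ (k : C) f : degR (k *: f) = k * degR f.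
Proof.
have H0 : (fun=> 0 : C) \in @hecke_pred R G G0 := valP (0 : H).
have := hecke_deg_linear hp k (valP f) H0.
rewrite [X in _ + X](_ : _ = 0) ?addr0; last by apply: fsbig1.
by move=> <-; congr hecke_deg; apply/funext => x; rewrite addr0.
Qed.

Lemma degLZ (k : C) f : degL (k *: f) = k^* * degL f.
Proof. by rewrite /degL starZ degRZ. Qed.

Lemma degR_class x : degR (cl x) = (rnum x)%:C%C.
Proof.
have := @hecke_deg_char R G G0 hp x (fun=> 1) (fun _ _ => erefl).
rewrite mulr1 rmorph_nat => <-; congr hecke_deg.
by apply/funext => y; rewrite mulr1.
Qed.

Lemma degL_class x : degL (cl x) = (lnum x)%:C%C.
Proof. by rewrite /degL star_class degR_class Rnum_inv. Qed.

(** The positive multiple of [x] on which the product of the two degrees is 1. As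
    the degrees are multiplicative, this normalization is inherited by products,
    which is why W_t^* W_s depends only on the double coset of t^-1 s. *)
Definition hecke_unit x : H := ((Num.sqrt (rnum x * lnum x))^-1)%:C%C *: cl x.

Lemma hecke_unitE x y : DC x y -> hecke_unit y = hecke_unit x.
Proof.
by move=> xy; rewrite /hecke_unit (hecke_classE xy) (Rnum_eq xy) (Lnum_eq xy).
Qed.

Lemma rnum_gt0 x : 0 < rnum x.
Proof. by rewrite ltr0n Rnum_gt0. Qed.

Lemma lnum_gt0 x : 0 < lnum x.
Proof. by rewrite ltr0n Lnum_gt0. Qed.

Lemma deg_unit x : degR (hecke_unit x) * degL (hecke_unit x) = 1.
Proof.
have RL0 : 0 < rnum x * lnum x by rewrite mulr_gt0 ?rnum_gt0 ?lnum_gt0.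
rewrite /hecke_unit degRZ degLZ conjC_realC degR_class degL_class.
rewrite mulrACA -!(rmorphM (real_complex R)) -expr2 exprVn sqr_sqrtr ?ltW//.
by rewrite mulVf ?rmorph1// lt0r_neq0.
Qed.

Lemma hecke_unit_unique f x (c : R) : 0 <= c -> f = c%:C%C *: cl x ->
  degR f * degL f = 1 -> f = hecke_unit x.
Proof.
move=> c0 ->; rewrite degRZ degLZ conjC_realC degR_class degL_class.
rewrite mulrACA -!(rmorphM (real_complex R)) -expr2.
rewrite -(rmorph1 (real_complex R)) => /complexI c2.
have RL0 : 0 < rnum x * lnum x by rewrite mulr_gt0 ?rnum_gt0 ?lnum_gt0.
rewrite /hecke_unit; congr (_%:C%C *: _).
have -> : rnum x * lnum x = c^-1 ^+ 2.
  by rewrite exprVn; apply/esym/mulr1_eq.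
by rewrite sqrtr_sqr ger0_norm ?invr_ge0// invrK.
Qed.

Lemma hecke_W_unit s : Lnum G0 s = 1%N -> hecke_W R hp s = hecke_unit s.
Proof. by move=> s1; rewrite /hecke_unit s1 mulr1. Qed.

(** The product is a nonnegative multiple of a double coset, and the product of
    its degrees is 1: this determines it. *)
Lemma mul_unitr x s : Lnum G0 s = 1%N ->
  hecke_unit x * hecke_unit s = hecke_unit (x * s)%g.
Proof.
move=> s1; have [c c0 cE] := class_mulr x s1.
set u := hecke_unit x; set v := hecke_unit s.
apply: (@hecke_unit_unique _ _ ((Num.sqrt (rnum x * lnum x))^-1 *
   (Num.sqrt (rnum s * lnum s))^-1 * c)).
- by rewrite !mulr_ge0 ?invr_ge0 ?sqrtr_ge0.
- by rewrite /u /v /hecke_unit -scalerAl -scalerAr cE !scalerA -!rmorphM.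
- by rewrite degRM degLM mulrACA !deg_unit mulr1.
Qed.

Lemma star_unit x : star (hecke_unit x) = hecke_unit x^-1%g.
Proof.
by rewrite /hecke_unit starZ conjC_realC star_class Rnum_inv// Lnum_inv// [rnum x * _]mulrC.
Qed.

Lemma hecke_unit1 : hecke_unit 1%g = 1.
Proof.
have L1 : Lnum G0 1%g = 1%N.
  by apply/(Lnum1P hp) => h hG; rewrite invg1 mul1g mulg1.
have R1 : Rnum G0 1%g = 1%N by rewrite -[1%g]invg1 Rnum_inv.
by rewrite /hecke_unit L1 R1 mulr1 sqrtr1 invr1 scale1r.
Qed.

Lemma star_W_mul_W t s : Lnum G0 t = 1%N -> Lnum G0 s = 1%N ->
  star (hecke_W R hp t) * hecke_W R hp s = hecke_unit (t^-1 * s)%g.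
Proof. by move=> t1 s1; rewrite !hecke_W_unit// star_unit mul_unitr. Qed.

Lemma hecke_W_isometry s : Lnum G0 s = 1%N ->
  star (hecke_W R hp s) * hecke_W R hp s = 1.
Proof. by move=> s1; rewrite star_W_mul_W// mulVg hecke_unit1. Qed.

Lemma hecke_WM s t : Lnum G0 s = 1%N -> Lnum G0 t = 1%N ->
  hecke_W R hp s * hecke_W R hp t = hecke_W R hp (s * t)%g.
Proof. by move=> s1 t1; rewrite !hecke_W_unit ?Lnum1M// mul_unitr. Qed.

(** Induction on a list of double cosets covering the support: subtracting the
    value at y times [y] removes the double coset of y from the support. *)
Lemma hecke_ind (P : H -> Prop) : P 0 ->
  (forall (k : C) x f, P f -> P (k *: hecke_unit x + f)) -> forall f, P f.
Proof.
move=> P0 PD f; have /asboolP[_ [s]] := valP f.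
elim: s f => [|y s IH] f fs.
  suff -> : f = 0 by [].
  by apply: hecke_ext => x; apply/eqP/negPn/negP => /fs[].
pose q : C := (Num.sqrt (rnum y * lnum y))%:C%C.
have yE : f y *: cl y = (f y * q) *: hecke_unit y.
  rewrite scalerA -mulrA -rmorphM divff ?mulr1// lt0r_neq0// sqrtr_gt0.
  by rewrite mulr_gt0 ?rnum_gt0 ?lnum_gt0.
rewrite -[f](subrK (f y *: cl y)) addrC yE -yE; rewrite {1}yE; apply: PD; apply: IH => x.
rewrite -[X in X != 0]/(f x - f y * hecke_char R G0 y x).
have [yx|nyx] := pselect (DC y x).
  rewrite hecke_charE// mulr1; case: yx => h [k [hG kG ->]].
  by rewrite (hecke_invr (valP f))// (hecke_invl (valP f))// subrr eqxx.
rewrite /hecke_char memNset// mulr0 subr0 => /fs[z].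
by rewrite inE => /orP[/eqP -> //|zs zx]; exists z.
Qed.

Lemma hecke_unit_neq0 x : hecke_unit x x != 0.
Proof.
apply/eqP => e; have /hecke_supported : forall y, hecke_unit x y != 0 -> DC x y.
  move=> y; rewrite -[X in X != 0]/(_ * hecke_char R G0 x y) mulf_eq0 negb_or.
  by case/andP => _ /hecke_char_neq0.
rewrite e scale0r => u0; have := deg_unit x.
by rewrite u0 -(scale0r (0 : H)) degRZ !mul0r => /eqP; rewrite eq_sym oner_eq0.
Qed.

Lemma hecke_unit_eq x y : hecke_unit y x != 0 -> hecke_unit y = hecke_unit x.
Proof.
rewrite -[X in X != 0]/(_ * hecke_char R G0 y x) mulf_eq0 negb_or.
by case/andP => _ /hecke_char_neq0 /hecke_unitE.
Qed.

(** Elements of the family with different double cosets have disjoint supports, and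
    those with the same double coset are equal. *)
Lemma hecke_unit_basis : linear_basis (range hecke_unit).
Proof.
split=> [s c us sE s0 e es|f].
  have [x _ xe] : range hecke_unit e by apply: sE.
  have := congr1 (fun f : H => f x) s0.
  have -> : (\sum_(e <- s) c e *: e : H) x = \sum_(e <- s) c e * (e : H) x.
    elim: (s) => [|e' s' IH]; first by rewrite !big_nil.
    by rewrite !big_cons -IH.
  rewrite (bigD1_seq e)//= big_seq_cond big1 => [|e' /andP[/sE[y _ <-]]].
    rewrite addr0 => /eqP; rewrite mulf_eq0 -xe (negPf (hecke_unit_neq0 x)) orbF.
    by move=> /eqP.
  move=> ne; apply/eqP; rewrite mulf_eq0 -[_ || _]negbK negb_or; apply/negP.
  by case/andP=> _ /hecke_unit_eq ye; rewrite ye xe eqxx in ne.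
(* Requiring s to be duplicate-free makes the induction go through: a coefficient
   of a basis element that already occurs is added to the existing one. *)
suff [s [c [_ sE fE]]] : exists (s : seq H) (c : H -> C),
    [/\ uniq s, [set` s] `<=` range hecke_unit & f = \sum_(e <- s) c e *: e].
  by exists s, c.
elim/hecke_ind: f => [|k x f [s [c [us sE ->]]]].
  by exists [::], (fun=> 0); split; rewrite ?big_nil.
set e := hecke_unit x.
pose c' e' := if e' == e then k + (if e \in s then c e else 0) else c e'.
have [es|es] := boolP (e \in s).
  exists s, c'; split=> //; rewrite (bigD1_seq e)//= [RHS](bigD1_seq e)//=.
  rewrite /c' eqxx es scalerDl addrA; congr (_ + _).
  by apply: eq_bigr => e' /negPf ->.
exists (e :: s), c'; split; first by rewrite /= es.
  by move=> e' /=; rewrite inE => /orP[/eqP ->|/sE//]; exists x.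
rewrite big_cons /c' eqxx (negPf es) addr0; congr (_ + _).
rewrite big_seq [RHS]big_seq; apply: eq_bigr => e' e's.
by case: eqVneq => // ee; rewrite -ee e's in es.
Qed.

End HeckeBasis.

(** * The modular function and a one-dimensional representation *)

Section TrivialCharacter.
Variables (R : realType) (G : groupType) (G0 : groupClosed G).
Variable hp : hecke_pair G0.
Local Notation C := R[i].
Local Notation DC := (double_coset G0).
Local Notation H := (hecke_alg R hp).
Local Notation cl := (hecke_class R hp).
Local Notation rnum x := ((Rnum G0 x)%:R : R).
Local Notation lnum x := ((Lnum G0 x)%:R : R).
Implicit Types (f g : H) (x y z s t : G).

Hypothesis hfrac : forall x, exists t s,
  [/\ Lnum G0 t = 1%N, Lnum G0 s = 1%N & x = (t^-1 * s)%g].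

(** The square root of the modular function of the Hecke pair. *)
Definition sqrt_modulus x : R := Num.sqrt (lnum x / rnum x).

Lemma sqrt_modulus_gt0 x : 0 < sqrt_modulus x.
Proof. by rewrite sqrtr_gt0 divr_gt0 ?lnum_gt0 ?rnum_gt0. Qed.

Lemma sqrt_modulus_eq x y : DC x y -> sqrt_modulus y = sqrt_modulus x.
Proof. by move=> xy; rewrite /sqrt_modulus (Rnum_eq xy) (Lnum_eq xy). Qed.

Lemma sqrt_modulus1 : sqrt_modulus 1%g = 1.
Proof. by rewrite /sqrt_modulus -{1}invg1 Lnum_inv// divff ?sqrtr1// lt0r_neq0 ?rnum_gt0. Qed.

(** Comparing both degrees of the two sides of [x] [s] = c [x s]. *)
Lemma sqrt_modulus_mulr x s : Lnum G0 s = 1%N ->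
  sqrt_modulus (x * s)%g = sqrt_modulus x * sqrt_modulus s.
Proof.
move=> s1; have [c c0 cE] := class_mulr R hp x s1.
have := congr1 (@degR R G G0 hp) cE; have := congr1 (@degL R G G0 hp) cE.
rewrite degLM degRM degLZ degRZ conjC_realC !degL_class !degR_class.
rewrite -!(rmorphM (real_complex R)) => /complexI lE /complexI rE.
rewrite /sqrt_modulus -sqrtrM; last by rewrite divr_ge0.
congr Num.sqrt.
have r1 := lt0r_neq0 (rnum_gt0 R hp x); have r2 := lt0r_neq0 (rnum_gt0 R hp s).
have r3 := lt0r_neq0 (rnum_gt0 R hp (x * s)%g).
have cn0 : c != 0.
  by apply: contra_neq (mulf_neq0 r1 r2) => c00; rewrite rE c00 mul0r.
by rewrite mulf_div lE rE -mulf_div divff// mul1r.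
Qed.

(** Right multiplication by s, hence also by t^-1, multiplies the modular function
    by its value; these elements generate the group. *)
Lemma sqrt_modulusM x y : sqrt_modulus (x * y)%g = sqrt_modulus x * sqrt_modulus y.
Proof.
have [t [s [t1 s1 ->]]] := hfrac y.
have E z : sqrt_modulus (z * (t^-1 * s))%g * sqrt_modulus t =
    sqrt_modulus z * sqrt_modulus s.
  rewrite mulgA sqrt_modulus_mulr// mulrAC -(sqrt_modulus_mulr (z * t^-1)%g)//.
  by rewrite mulgVK.
apply: (mulIf (lt0r_neq0 (sqrt_modulus_gt0 t))).
have := E 1%g; rewrite mul1g sqrt_modulus1 mul1r => E1.
by rewrite E -mulrA E1.
Qed.

Lemma sqrt_modulus_biinv h k x : h \in G0 -> k \in G0 ->
  sqrt_modulus (h * x * k)%g = sqrt_modulus x.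
Proof. by move=> hG kG; apply: sqrt_modulus_eq; exists h, k. Qed.

Local Notation twist f := (fun x => f x * (sqrt_modulus x)%:C%C).

Lemma twist_in (f : G -> C) : f \in @hecke_pred R G G0 ->
  twist f \in @hecke_pred R G G0.
Proof.
move=> /asboolP[fi [s fs]]; apply/asboolP; split.
  by move=> h k x hG kG; rewrite fi// sqrt_modulus_biinv.
exists s => x; rewrite mulf_eq0 negb_or => /andP[fx _]; exact: fs.
Qed.

(** The analogue of the trivial representation. The degree itself is multiplicative
    but does not preserve the involution, which exchanges R and L; the twist by the
    modular function makes the value at [x] symmetric in R and L. *)
Definition hecke_chi f : C := hecke_deg G0 (twist f).

Lemma hecke_chiM f g : hecke_chi (f * g) = hecke_chi f * hecke_chi g.
Proof.
rewrite /hecke_chi -(hecke_deg_conv hp (twist_in (valP f)) (twist_in (valP g))).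
congr hecke_deg; apply/funext => x; rewrite /= /hecke_conv mulr_fsuml.
apply: eq_fsbigr => X _; rewrite mulrACA; congr (_ * _).
by rewrite -rmorphM -sqrt_modulusM mulgVK.
Qed.

Lemma hecke_chi_linear (k : C) f g :
  hecke_chi (k *: f + g) = k * hecke_chi f + hecke_chi g.
Proof.
rewrite /hecke_chi.
rewrite -(hecke_deg_linear hp k (twist_in (valP f)) (twist_in (valP g))).
by congr hecke_deg; apply/funext => x; rewrite mulrA -mulrDl.
Qed.

(** The value at [x] is R(x) sqrt (L(x) / R(x)) = sqrt (R(x) L(x)). *)
Lemma hecke_chi_unit x : hecke_chi (hecke_unit R hp x) = 1.
Proof.
have r0 := rnum_gt0 R hp x; have l0 := lnum_gt0 R hp x.
have := hecke_chi_linear ((Num.sqrt (rnum x * lnum x))^-1)%:C%C (cl x) 0.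
rewrite addr0 => ->.
have -> : hecke_chi 0 = 0 by apply: fsbig1 => X _; rewrite mul0r.
rewrite addr0 /hecke_chi.
rewrite (hecke_deg_char hp (m := fun y => (sqrt_modulus y)%:C%C)); last first.
  by move=> y /sqrt_modulus_eq ->.
rewrite -(rmorph_nat (real_complex R)) -!(rmorphM (real_complex R)).
rewrite -(rmorph1 (real_complex R)); congr _%:C%C.
rewrite sqrtrM ?ltW// /sqrt_modulus sqrtrM ?ltW// sqrtrV ?ltW//.
rewrite -{2}(sqr_sqrtr (ltW r0)); field.
by rewrite !gt_eqF ?sqrtr_gt0.
Qed.

Lemma hecke_chi_star f : hecke_chi (star f) = (hecke_chi f)^*.
Proof.
have chi0 : hecke_chi 0 = 0 by apply: fsbig1 => X _; rewrite mul0r.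
elim/hecke_ind: f => [|k x f IH]; first by rewrite star0 chi0 conjC0.
rewrite starD starZ star_unit !hecke_chi_linear !hecke_chi_unit IH.
by rewrite !mulr1 rmorphD.
Qed.

Lemma hecke_chi1 : hecke_chi 1 = 1.
Proof. by rewrite -(hecke_unit1 R hp) hecke_chi_unit. Qed.

End TrivialCharacter.

(** * The complex numbers as a Hilbert space *)

Section ComplexLine.
Variable R : realType.

(** A name of its own for the regular module, so that the structures declared below
    do not compete with those of the regular module of R. *)
Definition cline : Type := R[i]^o.

HB.instance Definition _ := NormedModule.copy cline R[i]^o.
HB.instance Definition _ := isPointed.Build cline (0 : R[i]).

Lemma normc_real (k : R) : `|k%:C%C : R[i]| = `|k|%:C%C.
Proof. by rewrite -norm_real Re_norm_real. Qed.

Lemma normc_i : `|'i%C : R[i]| = 1.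
Proof. by rewrite -norm_real Re_norm_i. Qed.

Lemma normc_le_ReIm (z : R[i]) : `|z| <= (`|complex.Re z| + `|complex.Im z|)%:C%C.
Proof.
rewrite {1}[z]complexE; apply: le_trans (ler_normD _ _) _.
by rewrite normrM normc_real normc_i mul1r normc_real rmorphD.
Qed.

Lemma normc_ge_Im (z : R[i]) : `|complex.Im z|%:C%C <= `|z|.
Proof.
have := normc_ge_Re (z * 'i%C); rewrite ReiNIm normrN normrM.
by rewrite normc_i mulr1.
Qed.

(** The real and imaginary parts of a Cauchy filter converge. *)
Lemma cline_complete (F : set_system cline) : ProperFilter F -> cauchy F -> cvg F.
Proof.
move=> FF /cauchy_ballP Fc.
have cvg_part (h : R[i] -> R) : (forall z w : R[i], `|h z - h w|%:C%C <= `|z - w|) ->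
    cvg ((h : cline -> R) @ F).
  move=> hle; apply/cauchy_cvgP/cauchy_ballP => e e0.
  have : 0 < e%:C%C :> R[i] by rewrite ltcR.
  move=> /Fc [[P Q] /= [PF QF] PQ]; exists (h @` P, h @` Q).
    by split; [apply: filterS PF|apply: filterS QF] => z Pz; exists z.
  move=> [_ _] /= [[z Pz <-] [w Qw <-]].
  have zw : `|(z : R[i]) - w| < e%:C%C by have := PQ (z, w) (conj Pz Qw).
  have : `|h z - h w|%:C%C < e%:C%C :> R[i] by exact: le_lt_trans zw.
  by rewrite ltcR.
have reF : cvg ((@complex.Re R : cline -> R) @ F).
  by apply: cvg_part => z w; rewrite -raddfB; apply: normc_ge_Re.
have imF : cvg ((@complex.Im R : cline -> R) @ F).
  by apply: cvg_part => z w; rewrite -raddfB; apply: normc_ge_Im.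
set l1 := lim _ in reF; set l2 := lim _ in imF.
apply/cvg_ex; exists (l1 +i* l2)%C; apply/cvgrPdist_lt => e e0.
have eE : e = (complex.Re e)%:C%C by rewrite RRe_real// gtr0_real.
have r0 : 0 < complex.Re e / 2 by rewrite divr_gt0// -ltcR -eE.
move/cvgrPdist_lt/(_ _ r0): reF => reF; move/cvgrPdist_lt/(_ _ r0): imF => imF.
near=> z; rewrite eE; apply: le_lt_trans (normc_le_ReIm _) _; rewrite ltcR.
have -> : complex.Re ((l1 +i* l2)%C - z) = l1 - complex.Re z by case: (z).
have -> : complex.Im ((l1 +i* l2)%C - z) = l2 - complex.Im z by case: (z).
rewrite [ltRHS]splitr ltrD//; near: z; [exact: reF|exact: imF].
Unshelve. all: by end_near. Qed.

HB.instance Definition _ := Uniform_isComplete.Build cline cline_complete.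

Definition cline_inner (z w : cline) : R[i] := (z : R[i]) * (w : R[i])^*.

Fact cline_inner_bilinear : bilinear_for *%R (Num.conj \; *%R) cline_inner.
Proof.
split=> [w|z] k u v; rewrite /cline_inner /=.
  by rewrite mulrDl -mulrA.
by rewrite rmorphD rmorphM mulrDr mulrCA.
Qed.

HB.instance Definition _ := bilinear_isBilinear.Build R[i] cline cline R[i]
  *%R (Num.conj \; *%R) cline_inner cline_inner_bilinear.

Fact cline_inner_hermitian (z w : cline) :
  cline_inner z w = (-1) ^+ false * (cline_inner w z)^*.
Proof. by rewrite expr0 mul1r /cline_inner rmorphM /= conjCK mulrC. Qed.

HB.instance Definition _ := isHermitianSesquilinear.Build R[i] cline false Num.conj
  cline_inner cline_inner_hermitian.

Fact cline_inner_gt0 (z : cline) : z != 0 -> 0 < cline_inner z z.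
Proof. by move=> z0; rewrite /cline_inner -normCK exprn_gt0// normr_gt0. Qed.

HB.instance Definition _ := isDotProduct.Build R[i] cline cline_inner cline_inner_gt0.

Fact cline_inner_norm (z : cline) : cline_inner z z = `|z| ^+ 2.
Proof. by rewrite /cline_inner -normCK. Qed.

HB.instance Definition _ := isHilbert.Build R cline cline_inner_norm.

End ComplexLine.

(** * The universal C*-seminorm *)

Section HilbertLemmas.
Variables (R : realType) (V : hilbertType R).
Implicit Types x y : V.

Lemma innerC x y : inner y x = (inner x y)^*.
Proof. by rewrite (hermC (@inner R V)) /= expr0 mul1r. Qed.

(** Cauchy-Schwarz for a nonnegative inner product, from the expansion of
    the squared norm of |y| x - |x| y. *)
Lemma inner_le x y : 0 <= inner x y -> inner x y <= `|x| * `|y|.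
Proof.
move=> xy0; have yx : inner y x = inner x y.
  by rewrite innerC geC0_conj.
have [x0|x0] := eqVneq `|x| 0.
  by move/normr0_eq0: x0 => ->; rewrite linear0l normr0 mul0r.
have [y0|y0] := eqVneq `|y| 0.
  by move/normr0_eq0: y0 => ->; rewrite linear0r normr0 mulr0.
have xy_gt0 : 0 < `|x| * `|y| by rewrite mulr_gt0// lt_neqAle eq_sym ?x0 ?y0 normr_ge0.
have cx : (`|x|)^* = `|x| by rewrite geC0_conj.
have cy : (`|y|)^* = `|y| by rewrite geC0_conj.
have : 0 <= inner (`|y| *: x - `|x| *: y) (`|y| *: x - `|x| *: y).
  by rewrite inner_norm exprn_ge0.
rewrite linearBl !linearBr /= !linearZl_LR !linearZr_LR /= cx cy yx.
rewrite !inner_norm => H; rewrite -subr_ge0.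
rewrite -(pmulr_rge0 _ (mulr_gt0 (ltr0Sn _ 1) xy_gt0)).
by move: H; congr (0 <= _); ring.
Qed.

End HilbertLemmas.

Section RepLemmas.
Variables (R : realType) (A : starAlgType R).
Implicit Types (a b : A) (M : R).

Section OneRep.
Variables (V : hilbertType R) (pi : A -> V -> V).
Hypothesis piR : star_rep pi.

Lemma rep_norm2 a x : inner (pi (star a * a) x) x = `|pi a x| ^+ 2.
Proof. by rewrite (rep_mul piR) (rep_star piR) inner_norm. Qed.

Lemma rep_norm2_le a x : `|pi a x| ^+ 2 <= `|pi (star a * a) x| * `|x|.
Proof.
rewrite -rep_norm2; apply: inner_le.
by rewrite rep_norm2 exprn_ge0.
Qed.

(** By Cauchy-Schwarz, |pi(a) x|^2 <= |pi(a) x| |x|. *)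
Lemma rep_projection a x : star a = a -> a * a = a -> `|pi a x| <= `|x|.
Proof.
move=> sa aa; have := rep_norm2_le a x; rewrite sa aa.
have [->|x0] := eqVneq `|pi a x| 0; first by [].
by rewrite expr2 ler_pM2l// lt_neqAle eq_sym x0 normr_ge0.
Qed.

Lemma rep_partial_isometry a e x : star e = e -> e * e = e -> star a * a = e ->
  `|pi a x| <= `|x|.
Proof.
move=> se ee ae; apply: le_trans (rep_projection x se ee).
rewrite -ler_sqr ?nnegrE// -rep_norm2 -[leRHS]rep_norm2.
by rewrite ae se ee.
Qed.

(** Representations may be degenerate, so that pi(a) is only a partial isometry,
    with initial projection pi(1); that of pi(a^* ) is pi(a a^* ). *)
Lemma rep_isometry_le a x : star a * a = 1 ->
  `|pi a x| <= `|x| /\ `|pi (star a) x| <= `|x|.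
Proof.
move=> aa; split; first by apply: rep_partial_isometry aa; rewrite ?star1 ?mulr1.
apply: (@rep_partial_isometry _ (a * star a)); rewrite ?starK//.
  by rewrite starM starK.
by rewrite mulrA -(mulrA a) aa mulr1.
Qed.

Lemma rep_op0 a : pi a 0 = 0.
Proof.
have := rep_op_linear piR a 1 0 0; rewrite !scale1r addr0 => /eqP.
by rewrite -subr_eq0 opprD addNKr oppr_eq0 => /eqP.
Qed.

Lemma rep0 x : pi 0 x = 0.
Proof.
have := rep_linear piR 1 0 0 x; rewrite !scale1r addr0 => /eqP.
by rewrite -subr_eq0 opprD addNKr oppr_eq0 => /eqP.
Qed.

Lemma opnorm_le a M : (opnorm (pi a) <= M%:E)%E <->
  0 <= M /\ forall x, `|pi a x| <= M%:C%C * `|x|.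
Proof.
split=> [piM|[M0 piM]]; last first.
  apply: ge_ereal_sup => _ [x /= x1 <-]; rewrite lee_fin.
  rewrite -lecR norm_real; apply: le_trans (piM x) _.
  by rewrite ler_piMr// ler0c.
have le1 x : `|x| <= 1 -> `|pi a x| <= M%:C%C.
  move=> x1; rewrite -norm_real lecR -lee_fin; apply: le_trans piM.
  by apply: ereal_sup_ubound; exists x.
have M0 : 0 <= M.
  by rewrite -ler0c; apply: le_trans (normr_ge0 (pi a 0)) (le1 _ _); rewrite normr0.
split=> // x; have [->|x0] := eqVneq x 0.
  by rewrite rep_op0 normr0 mulr0.
have nx : 0 < `|x| by rewrite normr_gt0.
have := le1 (`|x|^-1 *: x); rewrite normrZ normrV ?unitfE ?normr_eq0// normr_id.
rewrite mulVf ?lt0r_neq0// => /(_ (lexx _)).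
have -> : pi a (`|x|^-1 *: x) = `|x|^-1 *: pi a x.
  by have := rep_op_linear piR a `|x|^-1 x 0; rewrite !addr0 rep_op0 addr0.
rewrite normrZ normrV ?unitfE ?normr_eq0// normr_id mulrC ler_pdivrMr//.
Qed.

End OneRep.

Lemma univ_norm_leP a M : 0 <= M -> (univ_norm a <= M%:E)%E <->
  forall (V : hilbertType R) (pi : A -> V -> V), star_rep pi ->
    forall x, `|pi a x| <= M%:C%C * `|x|.
Proof.
move=> M0; split=> [aM V pi piR|piM].
  suff /(opnorm_le piR)[] : (opnorm (pi a) <= M%:E)%E by [].
  by apply: le_trans aM; apply: ereal_sup_ubound; exists V, pi.
apply: ge_ereal_sup => _ [V [pi [piR ->]]].
by apply/(opnorm_le piR); split=> //; apply: piM.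
Qed.

End RepLemmas.

Section Enveloping.
Variables (R : realType) (A : starAlgType R).
Implicit Types (a b : A) (M : R).
Hypothesis Aenv : has_enveloping A.
Hypothesis Anontriv : exists (V : hilbertType R) (pi : A -> V -> V) (x : V),
  star_rep pi /\ pi 1 x != 0.

Lemma univ_norm_ge0 a : (0 <= univ_norm a)%E.
Proof.
have [V [pi [x [piR _]]]] := Anontriv.
have : (opnorm (pi a) <= univ_norm a)%E.
  by apply: ereal_sup_ubound; exists V, pi.
apply: le_trans; apply: (@le_trans _ _ (complex.Re `|pi a 0|)%:E).
  by rewrite lee_fin -ler0c norm_real.
by apply: ereal_sup_ubound; exists 0; rewrite //= normr0.
Qed.

Definition env_norm a : R := fine (univ_norm a).

Lemma env_normE a : (env_norm a)%:E = univ_norm a.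
Proof. by rewrite fineK// ge0_fin_numE ?univ_norm_ge0. Qed.

Lemma env_norm_ge0 a : 0 <= env_norm a.
Proof. by rewrite -lee_fin env_normE univ_norm_ge0. Qed.

Lemma env_norm_rep a (V : hilbertType R) (pi : A -> V -> V) x : star_rep pi ->
  `|pi a x| <= (env_norm a)%:C%C * `|x|.
Proof.
move=> piR; apply: (iffLR (univ_norm_leP a (env_norm_ge0 a))) => //.
by rewrite env_normE.
Qed.

Lemma env_norm_le a M : 0 <= M -> (forall (V : hilbertType R) (pi : A -> V -> V),
  star_rep pi -> forall x, `|pi a x| <= M%:C%C * `|x|) -> env_norm a <= M.
Proof. by move=> M0 /(univ_norm_leP a M0); rewrite -env_normE lee_fin. Qed.

Lemma env_normD a b : env_norm (a + b) <= env_norm a + env_norm b.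
Proof.
apply: env_norm_le => [|V pi piR x]; first by rewrite addr_ge0 ?env_norm_ge0.
have -> : pi (a + b) x = pi a x + pi b x.
  by have := rep_linear piR 1 a b x; rewrite !scale1r.
apply: le_trans (ler_normD _ _) _; rewrite rmorphD mulrDl.
by rewrite lerD// env_norm_rep.
Qed.

Lemma env_normM a b : env_norm (a * b) <= env_norm a * env_norm b.
Proof.
apply: env_norm_le => [|V pi piR x]; first by rewrite mulr_ge0 ?env_norm_ge0.
rewrite (rep_mul piR) rmorphM -mulrA; apply: le_trans (env_norm_rep _ _ piR) _.
by rewrite ler_wpM2l ?ler0c ?env_norm_ge0// env_norm_rep.
Qed.

Lemma env_normZ_le (k : R[i]) a : env_norm (k *: a) <= complex.Re `|k| * env_norm a.
Proof.
have k0 : 0 <= complex.Re `|k| by rewrite -ler0c norm_real.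
apply: env_norm_le => [|V pi piR x]; first by rewrite mulr_ge0 ?env_norm_ge0.
have -> : pi (k *: a) x = k *: pi a x.
  by have := rep_linear piR k a 0 x; rewrite !addr0 (rep0 piR) addr0.
by rewrite normrZ realCM norm_real -mulrA ler_wpM2l// env_norm_rep.
Qed.

(** The reverse inequality is the same one for the inverse of k. *)
Lemma env_normZ (k : R[i]) a : env_norm (k *: a) = complex.Re `|k| * env_norm a.
Proof.
apply/le_anti; rewrite env_normZ_le andTb.
have [->|k0] := eqVneq k 0; first by rewrite normr0 mul0r env_norm_ge0.
have kk : complex.Re `|k| * complex.Re `|k^-1| = 1.
  by apply: complexI; rewrite realCM !norm_real -normrM divff// normr1.
have k1 : 0 <= complex.Re `|k| by rewrite -ler0c norm_real.
rewrite -[leRHS]mul1r -kk -mulrA ler_wpM2l//.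
by rewrite -{1}[a](scale1r a) -(mulVf k0) -scalerA env_normZ_le.
Qed.

(** In each representation |pi(a) x|^2 <= |pi(a^* a) x| |x|. *)
Lemma env_norm_star_ge a : env_norm a ^+ 2 <= env_norm (star a * a).
Proof.
rewrite -ler_sqrt ?env_norm_ge0// sqrtr_sqr ger0_norm ?env_norm_ge0//.
apply: env_norm_le => [|V pi piR x]; first exact: sqrtr_ge0.
rewrite -ler_sqr ?nnegrE ?mulr_ge0 ?ler0c ?sqrtr_ge0//.
rewrite exprMn -rmorphXn sqr_sqrtr ?env_norm_ge0//.
apply: le_trans (rep_norm2_le piR a x) _.
by rewrite expr2 mulrA ler_wpM2r// env_norm_rep.
Qed.

Lemma env_norm_star a : env_norm (star a * a) = env_norm a ^+ 2.
Proof.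
apply/le_anti; rewrite env_norm_star_ge andbT.
have le b : env_norm b <= env_norm (star b).
  have [->|b0] := eqVneq (env_norm b) 0; first exact: env_norm_ge0.
  have := le_trans (env_norm_star_ge b) (env_normM (star b) b).
  by rewrite expr2 ler_pM2r// lt_neqAle eq_sym b0 env_norm_ge0.
apply: le_trans (env_normM _ _) _.
by rewrite expr2 ler_wpM2r ?env_norm_ge0// -{2}(starK a) le.
Qed.

Lemma env_norm1_neq0 : env_norm 1 != 0.
Proof.
have [V [pi [x [piR x0]]]] := Anontriv.
apply: contra_neq x0 => n0; have := env_norm_rep 1 x piR.
by rewrite n0 mul0r normr_le0 => /eqP.
Qed.

(** The completion of A for the universal seminorm, which the representation with
    pi(1) nonzero makes a nonzero algebra. *)
Lemma enveloping_exists : exists (B : cstarAlgType R) (iota : {lrmorphism A -> B}),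
  is_enveloping iota.
Proof.
pose p := CstarSeminorm env_normD env_normZ env_normM env_norm_star env_norm1_neq0.
have [B [iota [iS iN iD]]] := cstar_completion p.
by exists B, iota; split=> // a; rewrite iN env_normE.
Qed.

End Enveloping.

(** * The enveloping algebra of the Hecke algebra *)

Section HeckeEnveloping.
Variables (R : realType) (G : groupType) (G0 : groupClosed G).
Variable hp : hecke_pair G0.
Local Notation H := (hecke_alg R hp).
Local Notation W := (hecke_W R hp).

Hypothesis hfrac : forall x, exists t s,
  [/\ Lnum G0 t = 1%N, Lnum G0 s = 1%N & x = (t^-1 * s)%g].

Lemma hecke_unit_fraction x : exists t s, [/\ Lnum G0 t = 1%N, Lnum G0 s = 1%N
  & hecke_unit R hp x = star (W t) * W s].
Proof.
have [t [s [t1 s1 ->]]] := hfrac x.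
by exists t, s; split=> //; rewrite star_W_mul_W.
Qed.

(** Representations map the W_s to partial isometries, so that the basis elements
    have norm at most 1. *)
Lemma hecke_has_enveloping : has_enveloping H.
Proof.
move=> f; suff [M [M0 fM]] : exists M : R, 0 <= M /\ (univ_norm f <= M%:E)%E.
  exact: le_lt_trans fM (ltry M).
elim/hecke_ind: f => [|k x f [M [M0 /(univ_norm_leP _ M0) fM]]].
  exists 0; split=> //; apply/univ_norm_leP => // V pi piR x.
  by rewrite (rep0 piR) normr0 mul0r.
have k0 : 0 <= complex.Re `|k| by rewrite -ler0c norm_real.
exists (complex.Re `|k| + M); split; first exact: addr_ge0.
apply/univ_norm_leP => [|V pi piR z]; first exact: addr_ge0.
rewrite (rep_linear piR) realCD mulrDl norm_real.
apply: le_trans (ler_normD _ _) _; apply: lerD; last exact: fM.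
rewrite normrZ; apply: ler_wpM2l => //.
have [t [s [t1 s1 ->]]] := hecke_unit_fraction x; rewrite (rep_mul piR).
have [_ tle] := rep_isometry_le piR (pi (W s) z) (hecke_W_isometry R hp t1).
have [sle _] := rep_isometry_le piR z (hecke_W_isometry R hp s1).
exact: le_trans tle sle.
Qed.

Definition chi_rep (f : H) (z : cline R) : cline R := (hecke_chi f : R[i]) *: z.

Lemma chi_rep_star_rep : star_rep chi_rep.
Proof.
split=> [f k z w|f|k f g z|f g z|f z w].
- by rewrite /chi_rep scalerDr !scalerA mulrC.
- apply: (@le_lt_trans _ _ (complex.Re `|hecke_chi f|)%:E); last exact: ltry.
  apply: ge_ereal_sup => _ [z z1 <-]; rewrite lee_fin -lecR !norm_real normrZ.
  exact: ler_piMr z1.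
- by rewrite /chi_rep hecke_chi_linear scalerDl scalerA.
- by rewrite /chi_rep hecke_chiM// scalerA.
- by rewrite /chi_rep hecke_chi_star// linearZl_LR linearZr_LR.
Qed.

Lemma hecke_enveloping_exists :
  exists (B : cstarAlgType R) (iota : {lrmorphism H -> B}), is_enveloping iota.
Proof.
apply: enveloping_exists hecke_has_enveloping _.
exists (cline R), chi_rep, (1 : R[i]); split; first exact: chi_rep_star_rep.
by rewrite /chi_rep hecke_chi1 scale1r oner_eq0.
Qed.

(** The images of the W_s are an isometric representation in the enveloping
    algebra, hence come from a morphism on the universal C*-algebra. Its range
    contains the span of the W_t^* W_s, which is dense, and so it is surjective. *)
Lemma hecke_enveloping_quotient (S : set G) (B : cstarAlgType R)
    (iota : {lrmorphism H -> B}) (U : cstarAlgType R) (v : G -> U) :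
  S = [set s | Lnum G0 s = 1%N] -> is_enveloping iota ->
  is_universal_isometric S v -> is_quotient U B.
Proof.
move=> SE [iS iN iD] [_ _ univ].
have [|phi [phiS phiv]] := univ B (fun s => iota (W s)).
  rewrite SE; split=> [s s1|s t s1 t1].
    by rewrite -iS -rmorphM hecke_W_isometry// rmorph1.
  by rewrite -rmorphM hecke_WM.
have sub : range iota `<=` range phi.
  move=> _ [f _ <-]; elim/hecke_ind: f => [|k x f [a _ aE]].
    by exists 0 => //; rewrite !raddf0.
  have [t [s [t1 s1 ->]]] := hecke_unit_fraction x.
  exists (k *: (star (v t) * v s) + a) => //.
  have phiE (y z a' : U) : phi (k *: (star y * z) + a') =
      k *: (star (phi y) * phi z) + phi a'.
    by rewrite -phiS -(rmorphM phi) linearP.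
  have iotaE (y z f' : H) : iota (k *: (star y * z) + f') =
      k *: (star (iota y) * iota z) + iota f'.
    by rewrite -iS -(rmorphM iota) linearP.
  rewrite phiE iotaE aE; congr (k *: (star _ * _) + _); by apply: phiv; rewrite SE.
exists phi; split=> //; apply: dense_range_surj => //.
apply/seteqP; split=> // b _ e e0.
have : cclosure (range iota) b by rewrite iD.
by move=> /(_ e e0)[a /sub aphi ba]; exists a.
Qed.

End HeckeEnveloping.

Theorem proposition1p4 (R : realType) (G : groupType) (G0 : groupClosed G)
  (hp : hecke_pair G0) (Sigma : set G)
  (hSigma : Sigma = [set s | Lnum G0 s = 1%N])
  (hfrac : forall g : G, exists t s, [/\ Sigma t, Sigma s & g = (t^-1 * s)%g]) :
  [/\ linear_basis [set x : hecke_alg R hp | exists t s,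
         [/\ Sigma t, Sigma s & x = star (hecke_W R hp t) * hecke_W R hp s]],
      has_enveloping (hecke_alg R hp),
      exists (B : cstarAlgType R) (iota : {lrmorphism hecke_alg R hp -> B}),
        is_enveloping iota
    & forall (B : cstarAlgType R) (iota : {lrmorphism hecke_alg R hp -> B}),
        is_enveloping iota ->
        forall (U : cstarAlgType R) (v : G -> U),
          is_universal_isometric Sigma v -> is_quotient U B].
Proof.
have hfrac' (x : G) : exists t s,
    [/\ Lnum G0 t = 1%N, Lnum G0 s = 1%N & x = (t^-1 * s)%g].
  by have [t [s []]] := hfrac x; rewrite hSigma => t1 s1 ->; exists t, s.
split.
- rewrite (_ : [set x | _] = range (hecke_unit R hp)); first exact: hecke_unit_basis.
  apply/seteqP; split=> [_ [t [s [St Ss ->]]]|_ [x _ <-]].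
    exists (t^-1 * s)%g => //; rewrite star_W_mul_W//.
      by move: St; rewrite hSigma.
    by move: Ss; rewrite hSigma.
  have [t [s [t1 s1 ->]]] := hecke_unit_fraction R hp hfrac' x.
  by exists t, s; rewrite hSigma.
- exact: hecke_has_enveloping.
- exact: hecke_enveloping_exists.
move=> B iota iE U v vU.
exact: (hecke_enveloping_quotient hfrac' hSigma iE vU).
Qed.
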